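(* The numerical range of $\mathsf{H}_\mu$, i.e. the set $$\{(\mathsf{H}_\mu\psi,\psi)_{L^2(\Omega)} : \psi\in\mathrm{dom}\,\mathsf{H}_\mu,\ \|\psi\|_{L^2(\Omega)}=1\},$$ is equal to $\mathbb{C}$.
   Context: Let $d\ge 2$ and let $\Omega\subset\mathbb{R}^d$ be a bounded, connected, $C^2$-smooth open set. Let $a\colon\Omega\to M_d(\mathbb{R})$ be a symmetric matrix function with real-valued entries in $C^1(\overline\Omega)$ such that for some $c>0$ one has $\xi\cdot a(x)\xi\ge c|\xi|^2$ for all $\xi\in\mathbb{R}^d$, $x\in\Omega$. Function spaces are complex-valued. Let $\mu$ be a Radon probability measure on $\Omega$ such that $H^2(\Omega)\ni u\mapsto \langle u\rangle_\mu := \int_\Omega u\,d\mu$ is a continuous functional on $H^2(\Omega)$. Write $\nabla\cdot a\nabla u=\sum_{i,j}\partial_i(a_{ij}\partial_j u)$. In the Hilbert space $L^2(\Omega)$ define the operator $$\mathsf{H}_\mu u := -\nabla\cdot a\nabla u,\qquad \mathrm{dom}\,\mathsf{H}_\mu := \{u\in H^2(\Omega): u|_{\partial\Omega}=\langle u\rangle_\mu\}$$ (the trace of $u$ on $\partial\Omega$ equals the constant $\langle u\rangle_\mu$). *)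

(* Defs.v *)
From HB Require Import structures.
From mathcomp Require Import all_boot all_order all_algebra.
From mathcomp Require Import complex.
From mathcomp Require Import all_classical all_reals all_analysis.
From mathcomp Require Import measurable_realfun.

Set Implicit Arguments.
Unset Strict Implicit.
Unset Printing Implicit Defensive.

Import Order.TTheory GRing.Theory Num.Theory.
Import numFieldNormedType.Exports.

Local Open Scope classical_set_scope.
Local Open Scope ring_scope.

Definition rV_display : measure_display.
Proof. exact: default_measure_display. Qed.

Section borel.
Context {R : realType} {n : nat}.

Definition borel_rV : set (set 'rV[R]_n) := <<s @open 'rV[R]_n >>.

Let borel0 : borel_rV set0.
Proof. exact: sigma_algebra0. Qed.

Let borelC A : borel_rV A -> borel_rV (~` A).
Proof. exact: sigma_algebraC. Qed.

Let borel_bigcup (F : (set 'rV[R]_n)^nat) :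
  (forall i, borel_rV (F i)) -> borel_rV (\bigcup_i F i).
Proof. exact: sigma_algebra_bigcup. Qed.

HB.instance Definition _ := @isMeasurable.Build rV_display 'rV[R]_n
  borel_rV borel0 borelC borel_bigcup.

End borel.

Section borel_coord.
Context {R : realType}.

Lemma measurable_coord n (i : 'I_n) :
  measurable_fun setT (fun x : 'rV[R]_n => x ord0 i : R).
Proof.

apply: (measurability _ (RGenOInfty.measurableE R)).
move=> _ [_ [a ->] <-]; rewrite setTI.
apply: sub_sigma_algebra => /=.
apply: open_comp; last exact: interval_open.
by move=> x _; exact: coord_continuous.
Qed.

Lemma measurable_fun_rV d (T : measurableType d) n (f : T -> 'rV[R]_n) :
  (forall i, measurable_fun setT (fun t => f t ord0 i : R)) ->
  measurable_fun setT f.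
Proof.
move=> mf; apply: (measurability _ (erefl : measurable = <<s @open 'rV[R]_n >>)).
move=> _ [U oU <-]; rewrite setTI.
pose c (p : 'rV[rat]_n * nat) : 'rV[R]_n := map_mx ratr p.1.
pose e (p : 'rV[rat]_n * nat) : R := p.2.+1%:R^-1.
pose F p := if `[< ball (c p) (e p) `<=` U >] then f @^-1` ball (c p) (e p)
            else set0.
have -> : f @^-1` U = \bigcup_p F p.
  apply/seteqP; split => [t Uft|t [p _]]; last first.
    by rewrite /F; case: ifPn => [/asboolP pU /pU|].
  move: oU; rewrite openE => /(_ _ Uft)/nbhs_ballP[r /= r0 rU].
  have [k kr] : exists k, k.+1%:R^-1 < r / 2 :> R.
    have r20 : 0 < r / 2 by rewrite divr_gt0.
    by have [k _ /(_ k (leqnn k))] := near_infty_natSinv_lt (PosNum r20); exists k.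
  have /choice[q qf] : forall i, exists q : rat, `|ratr q - f t ord0 i| < k.+1%:R^-1 :> R.
    move=> i.
    have /rat_in_itvoo[q /itvP qf] : f t ord0 i < f t ord0 i + k.+1%:R^-1 :> R.
      by rewrite ltrDl invr_gt0.
    exists q; rewrite ger0_norm ?subr_ge0 ?qf//.
    by rewrite ltrBlDl qf.
  have cft : ball (c (\row_i q i, k)) (e (\row_i q i, k)) (f t).
    split; first by rewrite /e invr_gt0.
    by move=> i j; rewrite /ball/= !mxE (ord1 i).
  exists (\row_i q i, k) => //; rewrite /F.
  case: ifPn => // /asboolPn; apply: contra_notP => _ y cy.
  apply: rU; apply: (@le_ball _ _ _ (e (\row_i q i, k) + e (\row_i q i, k))).
    by rewrite /e/= [leRHS]splitr lerD// ltW.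
  by apply: ball_triangle cy; exact: ball_sym.
apply: countable_bigcupT_measurable; first exact: countableP.
move=> p; rewrite /F; case: ifPn => // _.
have -> : f @^-1` ball (c p) (e p) =
    \bigcap_(i in [set: 'I_n]) [set t | ball (c p ord0 i) (e p) (f t ord0 i)].
  apply/seteqP; split => t /=; first by move=> [_ +] i _; exact.
  move=> h; split; first by rewrite /e invr_gt0.
  by move=> i j; rewrite (ord1 i); exact: h.
apply: fin_bigcap_measurable => // i _.
have mb : measurable (ball (c p ord0 i) (e p)) by exact: measurable_ball.
by rewrite -[X in measurable X]setTI; exact: (mf i measurableT _ mb).
Qed.

End borel_coord.

Lemma product_sigma_finite d1 d2 (T1 : measurableType d1)
    (T2 : measurableType d2) (R : realType)
    (m1 : {sigma_finite_measure set T1 -> \bar R})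
    (m2 : {sigma_finite_measure set T2 -> \bar R}) :
  sigma_finite setT (product_measure1 m1 m2).
Proof.
have /sigma_finiteP[F [TF ndF Foo]] := sigma_finiteT m1.
have /sigma_finiteP[G [TG ndG Goo]] := sigma_finiteT m2.
exists (fun n => F n `*` G n).
  rewrite -setXTT TF TG predeqE => -[x y]; split.
    move=> [/= [n _ Fnx] [k _ Gky]]; exists (maxn n k) => //; split.
    - by move: x Fnx; exact/subsetPset/ndF/leq_maxl.
    - by move: y Gky; exact/subsetPset/ndG/leq_maxr.
  by move=> [n _ []/= ? ?]; split; exists n.
move=> k; have [? ?] := Foo k; have [? ?] := Goo k.
split; first exact: measurableX.
by rewrite product_measure1E// lte_mul_pinfty// ge0_fin_numE.
Qed.

Section pushforward_iso.
Context d1 d2 (T1 : measurableType d1) (T2 : measurableType d2) (R : realType).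
Variables (m : {measure set T1 -> \bar R}).
Variables (f : T1 -> T2) (g : T2 -> T1).
Hypotheses (mf : measurable_fun setT f) (mg : measurable_fun setT g).
Hypotheses (fK : cancel f g) (sm : sigma_finite setT m).

Let pf := pushforward m f.

Let pf0 : pf set0 = 0%E.
Proof. by rewrite /pf /pushforward preimage_set0 measure0. Qed.

Let pf_ge0 A : (0 <= pf A)%E.
Proof. exact: measure_ge0. Qed.

Let pf_sigma_additive : semi_sigma_additive pf.
Proof.
exact: (@measure_semi_sigma_additive _ _ _
  (measure_function_pushforward__canonical__measure_function_Measure m mf)).
Qed.

HB.instance Definition _ := isMeasure.Build _ _ _ pf
  pf0 pf_ge0 pf_sigma_additive.

Let pf_sigma_finite : sigma_finite setT pf.
Proof.
have [F FT Foo] := sm.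
exists (fun i => g @^-1` F i) => [|i].
  by rewrite -preimage_bigcup -FT preimage_setT.
have [mF moo] := Foo i; split.
  by rewrite -[X in measurable X]setTI; exact: mg.
rewrite /pf /pushforward -comp_preimage (_ : g \o f = id)//.
exact/funext/fK.
Qed.

HB.instance Definition _ := Measure_isSigmaFinite.Build _ _ _ pf
  pf_sigma_finite.

Lemma pushforward_sigma_finite :
  exists m' : {sigma_finite_measure set T2 -> \bar R}, pushforward m f = m'.
Proof. by exists pf. Qed.

End pushforward_iso.

Section lebesgue_rV.
Context {R : realType}.

Definition rV_cons n (p : R * 'rV[R]_n) : 'rV[R]_n.+1 :=
  row_mx (const_mx p.1 : 'rV_1) p.2.

Definition rV_uncons n (x : 'rV[R]_n.+1) : R * 'rV[R]_n :=
  (x ord0 ord0, \row_j x ord0 (lift ord0 j)).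

Lemma rV_consK n : cancel (@rV_cons n) (@rV_uncons n).
Proof.
move=> [t x]; rewrite /rV_uncons /rV_cons; congr pair.
  rewrite mxE; case: splitP => [j|[j hj]] //=; first by rewrite mxE.
apply/rowP => j; rewrite mxE -rshift1.
by rewrite (row_mxEr (const_mx t : 'rV_1) x).
Qed.

Lemma measurable_rV_cons n : measurable_fun setT (@rV_cons n).
Proof.
apply: measurable_fun_rV => i.
have -> : (fun p => rV_cons p ord0 i) = match fintype.split (i : 'I_(1 + n)) with
    inl _ => fst | inr j => (fun x : 'rV[R]_n => x ord0 j) \o snd end.
  apply/funext => p; rewrite /rV_cons mxE.
  by case: fintype.split => j//=; rewrite mxE.
case: fintype.split => j; first exact: measurable_fst.
by apply: measurableT_comp; [exact: measurable_coord|exact: measurable_snd].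
Qed.

Lemma measurable_rV_uncons n : measurable_fun setT (@rV_uncons n).
Proof.
apply: measurable_fun_pair; first exact: measurable_coord.
apply: measurable_fun_rV => i.
rewrite (_ : (fun _ => _) = (fun x : 'rV[R]_n.+1 => x ord0 (lift ord0 i))).
  exact: measurable_coord.
by apply/funext => x; rewrite mxE.
Qed.

(* n-dimensional Lebesgue measure as the n-fold product of the Lebesgue
   measure of the line *)
Fixpoint lebesgue_rV n : set 'rV[R]_n -> \bar R :=
  match n with
  | 0 => dirac (0 : 'rV[R]_0)
  | m.+1 => pushforward (product_measure1 lebesgue_measure (@lebesgue_rV m))
              (@rV_cons m)
  end.

Arguments lebesgue_rV : clear implicits.

Let lebesgue_rV_measure n :
  exists m : {sigma_finite_measure set 'rV[R]_n -> \bar R}, lebesgue_rV n = m.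
Proof.
elim: n => [|n [m mE]]; first by exists (dirac (0 : 'rV[R]_0)).
have [q qE] := @pushforward_sigma_finite _ _ (measurableTypeR R * 'rV[R]_n)%type
  _ _ (product_measure1 (@lebesgue_measure R) m) _ _ (@measurable_rV_cons n)
  (@measurable_rV_uncons n) (@rV_consK n) (product_sigma_finite _ m).
by exists q; rewrite -qE /= mE.
Qed.

Let lebesgue_rV0 n : lebesgue_rV n set0 = 0%E.
Proof. by have [m ->] := lebesgue_rV_measure n. Qed.

Let lebesgue_rV_ge0 n A : (0 <= lebesgue_rV n A)%E.
Proof. by have [m ->] := lebesgue_rV_measure n. Qed.

Let lebesgue_rV_sigma_additive n : semi_sigma_additive (lebesgue_rV n).
Proof.
by have [m ->] := lebesgue_rV_measure n; exact: measure_semi_sigma_additive.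
Qed.

HB.instance Definition _ n := isMeasure.Build _ _ _ (lebesgue_rV n)
  (lebesgue_rV0 n) (@lebesgue_rV_ge0 n) (@lebesgue_rV_sigma_additive n).

Let lebesgue_rV_sigma_finite n : sigma_finite setT (lebesgue_rV n).
Proof. by have [m ->] := lebesgue_rV_measure n; exact: sigma_finiteT. Qed.

HB.instance Definition _ n := Measure_isSigmaFinite.Build _ _ _
  (lebesgue_rV n) (@lebesgue_rV_sigma_finite n).

End lebesgue_rV.
Arguments lebesgue_rV {R} n.

Section hausdorff.
Context {R : realType} {n : nat}.
Implicit Types (A : set 'rV[R]_n) (delta : R) (s : nat).

(* the norm of the library on 'rV[R]_n is the sup norm *)
Definition enorm (x : 'rV[R]_n) : R := Num.sqrt (\sum_i x ord0 i ^+ 2).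

(* diam(A)^s, which is 0 on the empty set *)
Definition diamX s A : \bar R :=
  ereal_sup [set z | z = 0%E \/
    exists x y, [/\ A x, A y & z = (enorm (x - y) ^+ s)%:E]].

Definition hausdorff_gauge s delta A : \bar R :=
  if `[< forall x y, A x -> A y -> enorm (x - y) <= delta >] then diamX s A
  else +oo%E.

(* Without the normalizing constant depending only on s. The coverings in
   mu_ext are by Borel sets; this is no restriction, a set and its closure
   having the same diameter. *)
Definition hausdorff s A : \bar R :=
  ereal_sup [set mu_ext (hausdorff_gauge s delta) A | delta in [set e | 0 < e]].

Let gauge_ge0 s delta A : (0 <= hausdorff_gauge s delta A)%E.
Proof.
by rewrite /hausdorff_gauge; case: ifPn => // _; apply: ereal_sup_ubound; left.
Qed.

Let gauge0 s delta : 0 < delta -> hausdorff_gauge s delta set0 = 0%E.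
Proof.
move=> d0; rewrite /hausdorff_gauge; case: ifPn => [_|/asboolPn]; last first.
  by move=> h; exfalso; apply: h.
rewrite /diamX (_ : [set _ | _] = [set 0%E]) ?ereal_sup1//.
apply/seteqP; split => z /=; last by move=> ->; left.
by case=> // -[x [y []]].
Qed.

Let hausdorff0 s : hausdorff s set0 = 0%E.
Proof.
rewrite /hausdorff (_ : [set _ | _ in _] = [set 0%E]) ?ereal_sup1//.
apply/seteqP; split => [z [delta d0 <-]|z ->] /=.
  by apply: mu_ext0 => //; exact: gauge0.
by exists 1 => //=; apply: mu_ext0 => //; exact: gauge0.
Qed.

Let hausdorff_ge0 s A : (0 <= hausdorff s A)%E.
Proof.
apply: (@le_trans _ _ (mu_ext (hausdorff_gauge s 1) A)); first exact: mu_ext_ge0.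
by apply: ereal_sup_ubound; exists 1 => /=.
Qed.

Let le_hausdorff s : {homo hausdorff s : A B / A `<=` B >-> (A <= B)%E}.
Proof.
move=> A B AB; apply: ge_ereal_sup => _ [delta d0 <-].
apply: (@le_trans _ _ (mu_ext (hausdorff_gauge s delta) B)); first exact: le_mu_ext.
by apply: ereal_sup_ubound; exists delta.
Qed.

Let hausdorff_sigma_subadditive s : sigma_subadditive (hausdorff s).
Proof.
move=> F; apply: ge_ereal_sup => _ [delta d0 <-].
apply: le_trans (mu_ext_sigma_subadditive _ F) _ => //.
apply: lee_nneseries => i _ *; first exact: mu_ext_ge0.
by apply: ereal_sup_ubound; exists delta.
Qed.

HB.instance Definition _ s := isOuterMeasure.Build R 'rV[R]_n (hausdorff s)
  (hausdorff0 s) (@hausdorff_ge0 s) (@le_hausdorff s)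
  (@hausdorff_sigma_subadditive s).

(* its restriction to the Caratheodory-measurable sets, which include the
   Borel sets *)
Definition hausdorff_measure s :
    {measure set (caratheodory_type (hausdorff s)) -> \bar R} :=
  OuterMeasure.sort (hausdorff s : {outer_measure set 'rV[R]_n -> \bar R}).

End hausdorff.

Section calculus.
Context {R : realType} {n : nat}.
Local Notation E := 'rV[R]_n.
Implicit Types (f : E -> R) (U : set E).

Definition pd (i : 'I_n) f : E -> R := fun x => 'D_(delta_mx ord0 i) f x.

Fixpoint Ck (k : nat) U f : Prop :=
  (forall x, U x -> {for x, continuous f}) /\
  (if k is m.+1 then
     forall i, (forall x, U x -> derivable f x (delta_mx ord0 i)) /\
               Ck m U (pd i f)
   else True).

Definition extends_to_closure U f :=
  exists F : E -> R, {within closure U, continuous F} /\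
                     forall x, U x -> F x = f x.

Definition C1_closure U f :=
  [/\ Ck 1 U f, extends_to_closure U f &
      forall i, extends_to_closure U (pd i f)].

Definition bdry U : set E := closure U `\` interior U.

(* C_c^\infty(U); as weak_pd is linear in the test function, real-valued test
   functions suffice *)
Definition test_function U f :=
  (forall k, Ck k setT f) /\
  exists K, [/\ compact K, K `<=` U & forall x, ~ K x -> f x = 0].

End calculus.

(* after relabeling and reorienting the axes, U is locally the strict
   epigraph of a C^2 function *)
Definition C2_smooth (R : realType) (n : nat) (U : set 'rV[R]_n) :=
  forall x0, bdry U x0 ->
  exists (r : R) (i : 'I_n) (upward : bool) (gamma : 'rV[R]_n.-1 -> R),
    [/\ 0 < r, Ck 2 setT gamma &
      forall x, ball x0 r x ->
        (U x <-> if upward then gamma (col' i x) < x ord0 i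
                 else x ord0 i < gamma (col' i x))].

Section L2.
Context {R : realType} d (T : measurableType d).
Variables (m : {measure set T -> \bar R}) (D : set T).
Implicit Types u v : T -> R[i].

Definition sqnormc (z : R[i]) : R := complex.Re z ^+ 2 + complex.Im z ^+ 2.

Definition measurable_cfun u :=
  measurable_fun D (fun x => complex.Re (u x)) /\
  measurable_fun D (fun x => complex.Im (u x)).

Definition cintegral u : R[i] :=
  ((\int[m]_(x in D) complex.Re (u x))%R +i*
   (\int[m]_(x in D) complex.Im (u x))%R)%C.

Definition L2sq u : \bar R := (\int[m]_(x in D) (sqnormc (u x))%:E)%E.

Definition in_L2 u := measurable_cfun u /\ (L2sq u < +oo)%E.

Definition L2inner u v : R[i] := cintegral (fun x => u x * (v x)^*%C).

End L2.

Section sobolev.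
Context {R : realType} {n : nat}.
Local Notation E := 'rV[R]_n.
Local Notation leb := (@lebesgue_rV R n).
Variable Omega : set E.
Implicit Types u v : E -> R[i].

(* Elements of L^2(Omega) are handled through representatives defined on the
   whole space; only their values in Omega matter. *)

Definition weak_pd (i : 'I_n) u v :=
  forall phi : E -> R, test_function Omega phi ->
    cintegral leb Omega (fun x => u x * (pd i phi x)%:C%C) =
    - cintegral leb Omega (fun x => v x * (phi x)%:C%C).

(* u is in H^1(Omega) and g is its weak gradient *)
Definition H1_grad u (g : 'I_n -> E -> R[i]) :=
  in_L2 leb Omega u /\ forall i, in_L2 leb Omega (g i) /\ weak_pd i u (g i).

(* u is in H^2(Omega), g is its weak gradient and h its weak Hessian *)
Definition H2_jet u (g : 'I_n -> E -> R[i]) (h : 'I_n -> 'I_n -> E -> R[i]) :=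
  H1_grad u g /\ forall i, H1_grad (g i) (h i).

Definition in_H2 u := exists g h, H2_jet u g h.

Definition H2sq u (g : 'I_n -> E -> R[i]) (h : 'I_n -> 'I_n -> E -> R[i]) :=
  (L2sq leb Omega u + \sum_i L2sq leb Omega (g i)
   + \sum_i \sum_j L2sq leb Omega (h i j))%E.

Definition cfun_continuous_closure u :=
  {within closure Omega, continuous (fun x => complex.Re (u x))} /\
  {within closure Omega, continuous (fun x => complex.Im (u x))}.

Definition H1_cvg (phi : nat -> E -> R[i]) u :=
  exists (G : nat -> 'I_n -> E -> R[i]) (g : 'I_n -> E -> R[i]),
    [/\ forall k, H1_grad (phi k) (G k), H1_grad u g,
        L2sq leb Omega (phi k \- u) @[k --> \oo] --> 0%E &
        forall i, L2sq leb Omega (G k i \- g i) @[k --> \oo] --> 0%E].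

Definition surface := @hausdorff_measure R n n.-1.

(* The trace H^1(Omega) -> L^2(bdry Omega) as the continuous extension of the
   restriction to the boundary of the functions in H^1(Omega) that are
   continuous up to the boundary. *)
Definition is_trace u (b : E -> R[i]) :=
  measurable_cfun (bdry Omega : set (caratheodory_type (hausdorff n.-1))) b /\
  exists phi : nat -> E -> R[i],
    [/\ forall k, cfun_continuous_closure (phi k), H1_cvg phi u &
        L2sq surface (bdry Omega) (phi k \- b) @[k --> \oo] --> 0%E].

End sobolev.

Section operator.
Context {R : realType} {n : nat}.
Local Notation E := 'rV[R]_n.
Local Notation leb := (@lebesgue_rV R n).
Variable Omega : set E.

(* A Radon measure on Omega is encoded as a Borel measure on the whole space,
   carried by Omega. Only inner regularity is stated: local finiteness is
   automatic for a probability. *)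
Definition radon (mu : set E -> \bar R) :=
  forall A, measurable A ->
    mu A = ereal_sup [set mu K | K in [set K | compact K /\ K `<=` A]].

(* avg is the functional u |-> \int_Omega u dmu on H^2(Omega), assumed to be
   continuous. When n >= 4 an element of H^2(Omega) need not be continuous, and
   the integral has no direct meaning for, say, a mu carried by a Lebesgue-null
   set: avg is the continuous linear functional given by the integral on
   those u that are continuous on the closure of Omega, which are dense in
   H^2(Omega), so that mu determines avg on H^2(Omega). *)
Definition H2_mean (mu : {measure set E -> \bar R}) (avg : (E -> R[i]) -> R[i]) :=
  [/\ forall (k : R[i]) u v, in_H2 Omega u -> in_H2 Omega v ->
        avg (fun x => k * u x + v x) = k * avg u + avg v,
      exists C : R, forall u g h, H2_jet Omega u g h ->
        ((sqnormc (avg u))%:E <= C%:E * H2sq Omega u g h)%E &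
      forall u, in_H2 Omega u -> cfun_continuous_closure Omega u ->
        avg u = cintegral mu Omega u].

Variables (a : E -> 'M[R]_n) (avg : (E -> R[i]) -> R[i]).

(* g is the gradient of u, and h i j = d_i (a_ij d_j u) *)
Definition minus_div_a_grad (u f : E -> R[i]) :=
  exists g h, [/\ H1_grad Omega u g,
    forall i j, in_L2 leb Omega (h i j) /\
      weak_pd Omega i (fun x => (a x i j)%:C%C * g j x) (h i j) &
    forall x, Omega x -> f x = - \sum_i \sum_j h i j x].

Definition dom_Hmu (u : E -> R[i]) :=
  in_H2 Omega u /\ is_trace Omega u (fun=> avg u).

Definition Hmu (u f : E -> R[i]) := dom_Hmu u /\ minus_div_a_grad u f.

Definition numerical_range (T : (E -> R[i]) -> (E -> R[i]) -> Prop) : set R[i] :=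
  [set z | exists psi f,
    [/\ T psi f, L2sq leb Omega psi = 1%E & z = L2inner leb Omega f psi]].

End operator.

(* Main.v *)
Require Import Defs.
From mathcomp Require Import all_boot all_order all_algebra.
From mathcomp Require Import complex.
From mathcomp Require Import all_classical all_reals all_analysis.
From mathcomp Require Import measurable_realfun.
From mathcomp Require Import ring lra.
Import Order.TTheory GRing.Theory Num.Theory.
Import numFieldNormedType.Exports.
Local Open Scope classical_set_scope.
Local Open Scope ring_scope.
Set Implicit Arguments.
Unset Strict Implicit.
Unset Printing Implicit Defensive.

(** The quadratic form of the operator sees the flux of a state through the
    boundary, and this flux can be kept of order one while all the volume
    quantities of the state are made arbitrarily small.

    Constants belong to the domain, since mu is a probability, and the operator
    kills them. Let w be a real C^2 function that vanishes on the boundary and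
    has mu-mean zero, and let L w = - div (a grad w). For k real and t complex,
    psi = k + k t w lies in the domain (its trace and its mean are both k), and
      |psi|^2 = k^2 nu,  nu = |Omega| + 2 Re t (int w) + |t|^2 (int w^2),
      (H psi, psi) = k^2 (t F + |t|^2 A),  F = int L w,  A = int (L w) w.
    So z is in the numerical range as soon as t F + |t|^2 A = z nu for some t.
    For a prescribed s = |t|^2 this equation and the definition of nu make t an
    affine function of s; what remains is one real equation in s, solved by the
    intermediate value theorem when A, int w and int w^2 are small compared
    with F ([numerical_range_equation]).

    Such functions w are boundary layers. Near a boundary point the domain is
    {rho > 0} with rho = +-(x_e - gamma) of class C^2 ([boundary_collar]). Take a
    bump chi there and w_N = chi theta(N rho) / N, where theta(0) = 0, theta'
    decreases from 1 to 0 on [0, 2] and theta is constant afterwards. Then w_N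
    is of class C^2 on the whole space, vanishes on the boundary, and
      L w_N = r_N + N hat(N rho) chi (a grad rho . grad rho)
    with r_N uniformly bounded and pointwise null, and hat = - theta'' >= 0
    ([div_grad_blayer]). By ellipticity the concentrating term is nonnegative,
    and its integral stays away from 0: an integration by parts along the axis
    e on the whole space turns the integral of N hat(N rho) chi into that of
    -+ (d_e chi) ramp(N rho), with ramp the primitive of hat, and chi is chosen
    to decrease towards the inside of the domain ([flux_lower_bound]). No
    integral over the boundary occurs. All the other integrals tend to 0 by
    dominated convergence; for (L w_N) w_M this uses theta(s) <= s, which
    compensates the factor N. Subtracting from w_N a small multiple of one fixed
    layer makes the mu-mean vanish
    ([mean_zero_layer]).

    As all the functions are of class C^2, weak derivatives reduce to the
    vanishing of the integral of a partial derivative of a compactly supported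
    function, obtained from Fubini and the fundamental theorem of calculus
    ([integral_pd_eq0]), and the trace is the restriction to the boundary. *)

(** * Lebesgue measure and compactness in R^n *)

Lemma continuous_measurable_rV (R : realType) n (D : set 'rV[R]_n)
    (f : 'rV[R]_n -> R) :
  open D -> (forall x, D x -> {for x, continuous f}) -> measurable_fun D f.
Proof.
move=> oD cf; apply: (measurability _ (RGenOInfty.measurableE R)).
move=> _ [_ [a ->] <-]; apply: sub_sigma_algebra => /=.
rewrite openE => x [Dx fx]; apply: filterI; first exact: open_nbhs_nbhs.
apply: (cf _ Dx); apply: open_nbhs_nbhs; split => //.
Qed.

Lemma open_measurable_rV (R : realType) n (D : set 'rV[R]_n) :
  open D -> measurable D.
Proof. by move=> oD; exact: sub_sigma_algebra. Qed.

Lemma rV_cons_head (R : realType) n (t : R) (x : 'rV[R]_n) :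
  rV_cons (t, x) ord0 ord0 = t.
Proof. by have /(congr1 fst) := rV_consK (t, x). Qed.

Lemma rV_cons_tail (R : realType) n (t : R) (x : 'rV[R]_n) k :
  rV_cons (t, x) ord0 (lift ord0 k) = x ord0 k.
Proof. by have /(congr1 snd)/rowP/(_ k) := rV_consK (t, x); rewrite mxE. Qed.

Lemma ball_rV_cons (R : realType) n (c : 'rV[R]_n.+1) (r : R) : 0 < r ->
  @rV_cons R n @^-1` ball c r =
  ball (c ord0 ord0) r `*` ball (rV_uncons c).2 r.
Proof.
move=> r0; apply/seteqP; split => -[t x] /=.
  case=> _ h; split => /=; first by have := h ord0 ord0; rewrite rV_cons_head.
  split => // i j; rewrite (ord1 i) mxE.
  by have := h ord0 (lift ord0 j); rewrite rV_cons_tail.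
case=> /= h0 [_ h]; split => // i j; rewrite (ord1 i).
case: (unliftP ord0 j) => [k ->|->]; last by rewrite rV_cons_head.
by have := h ord0 k; rewrite mxE rV_cons_tail.
Qed.

Lemma lebesgue_rV_ball (R : realType) n (c : 'rV[R]_n) (r : R) : 0 < r ->
  lebesgue_rV n (ball c r) = ((r *+ 2) ^+ n)%:E.
Proof.
move=> r0; elim: n c => [|n ih] c.
  rewrite /= diracE mem_set//; split => // i [].
  by case.
rewrite /lebesgue_rV -/lebesgue_rV /pushforward ball_rV_cons//.
rewrite product_measure1E; last 2 first.
- exact: measurable_ball.
- by apply: open_measurable_rV; exact: ball_open.
transitivity (lebesgue_measure (ball (c ord0 ord0) r) * ((r *+ 2) ^+ n)%:E)%E.
  by congr (_ * _)%E; exact: ih.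
by rewrite lebesgue_measure_ball ?ltW// -EFinM exprS.
Qed.

(** A directional derivative depends only on the restriction to a line. This
    transfers derivatives between functions of different spaces that agree
    along corresponding lines: slices, functions of fewer coordinates, and the
    reduction of the chain rule to one variable. *)
Lemma is_derive_along (R : numFieldType) (V V' W : normedModType R)
    (f : V -> W) (f' : V' -> W) (x v : V) (x' v' : V') (df : W) :
  (forall h : R, f' (h *: v' + x') = f (h *: v + x)) ->
  is_derive x v f df -> is_derive x' v' f' df.
Proof.
move=> ff' [dfx fdf].
have f0 : f' x' = f x by have := ff' 0; rewrite !scale0r !add0r.
have E : (fun h => h^-1 *: ((f' \o shift x') (h *: v') - f' x')) =
         (fun h => h^-1 *: ((f \o shift x) (h *: v) - f x)).
  by apply/funext => h /=; rewrite f0 ff'.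
by split; rewrite /derivable /derive E.
Qed.

Lemma compact_bounded_fun (R : realType) (T : topologicalType) (K : set T)
    (f : T -> R) :
  compact K -> {within K, continuous f} ->
  exists M : R, forall x, K x -> `|f x| <= M.
Proof.
move=> cK cf; have /compact_bounded[M [_ hM]] := continuous_compact cf cK.
by exists (M + 1) => x Kx; apply: (hM (M + 1)); [rewrite ltrDl|exists x].
Qed.

Lemma bounded_norm_le (R : realType) n (D : set 'rV[R]_n) :
  bounded_set D -> exists M : R, forall x, D x -> `|x| <= M.
Proof.
move=> [M [_ hM]]; exists (M + 1) => x Dx.
by apply: (hM (M + 1)) => //; rewrite ltrDl.
Qed.

Lemma norm_le_compact (R : realType) n (M : R) :
  compact [set x : 'rV[R]_n | `|x| <= M].
Proof.
apply: bounded_closed_compact.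
  by exists M; split; [rewrite num_real|move=> N MN x /= /le_trans; apply; exact: ltW].
have -> : [set x : 'rV[R]_n | `|x| <= M] = closed_ball_ Num.Def.normr 0 M.
  by apply/seteqP; split => x; rewrite /closed_ball_ /= sub0r normrN.
exact: closed_closed_ball_.
Qed.

Lemma norm_le_measurable (R : realType) n (M : R) :
  measurable [set x : 'rV[R]_n | `|x| <= M].
Proof.
rewrite -[X in measurable X]setCK; apply: measurableC.
apply: open_measurable_rV; apply: closed_openC.
by apply: compact_closed; [exact: norm_hausdorff|exact: norm_le_compact].
Qed.

Lemma norm_le_lebesgue_rV (R : realType) n (M : R) :
  (lebesgue_rV n [set x : 'rV[R]_n | (`|x| <= M)%R] < +oo)%E.
Proof.
have M0 : 0 < `|M| + 1 by rewrite ltr_pwDr.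
apply: (@le_lt_trans _ _ (lebesgue_rV n (ball (0 : 'rV[R]_n) (`|M| + 1)))).
  apply: le_measure; rewrite ?inE.
  - exact: norm_le_measurable.
  - by apply: open_measurable_rV; exact: ball_open.
  - move=> x /= xM; rewrite -ball_normE /= sub0r normrN (le_lt_trans xM)//.
    by rewrite ltr_pwDr// ler_norm.
by rewrite lebesgue_rV_ball// ltry.
Qed.

Lemma bounded_lebesgue_rV (R : realType) n (D : set 'rV[R]_n) :
  bounded_set D -> measurable D -> (lebesgue_rV n D < +oo)%E.
Proof.
move=> /bounded_norm_le[M hM] mD.
apply: le_lt_trans (norm_le_lebesgue_rV n M).
apply: le_measure; rewrite ?inE//.
exact: norm_le_measurable.
Qed.

Section compact_support.
Context {R : realType} {n : nat}.
Implicit Types f : 'rV[R]_n -> R.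

Lemma continuous_support_bounded f (M : R) : continuous f ->
  (forall x, M < `|x| -> f x = 0) -> exists N : R, forall x, `|f x| <= N.
Proof.
move=> cf f0.
have [N hN] := compact_bounded_fun (@norm_le_compact R n M) (continuous_subspaceT cf).
exists (Num.max N 0) => x; rewrite le_max.
have [xM|/f0->] := leP `|x| M; first by rewrite hN.
by rewrite normr0 lexx orbT.
Qed.

Lemma continuous_support_integrable f (M : R) : continuous f ->
  (forall x, M < `|x| -> f x = 0) ->
  (lebesgue_rV n).-integrable setT (EFin \o f).
Proof.
move=> cf f0; have [N hN] := continuous_support_bounded cf f0.
pose K := [set x : 'rV[R]_n | `|x| <= M].
have mK : measurable K by exact: norm_le_measurable.
have -> : EFin \o f = (EFin \o f) \_ K.
  apply/funext => x; rewrite patchE; case: ifPn => //.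
  by rewrite notin_setE /K /= => /negP; rewrite -ltNge => /f0 ->.
apply: (integrable_mkcond _ mK).1.
apply: measurable_bounded_integrable => //.
- exact: norm_le_lebesgue_rV.
- apply: measurable_funS (@subsetT _ K) _ => //.
  by apply: continuous_measurable_rV; [exact: openT|move=> x _; exact: cf].
- exists N; split; first by rewrite num_real.
  by move=> N' NN' x _ /=; rewrite (le_trans (hN x))// ltW.
Qed.

End compact_support.

(** * The integral of a partial derivative *)

Lemma continuous_rV_cons (R : realType) n (x : R * 'rV[R]_n) :
  {for x, continuous (@rV_cons R n)}.
Proof.
case: x => t x A /nbhs_ballP[e /= e0 eA].
exists (ball t e, ball x e).
  by split => /=; exact: nbhsx_ballx.
case=> s y /= [ts xy]; apply: eA; split => // i j; rewrite (ord1 i).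
case: (unliftP ord0 j) => [k ->|->]; last by rewrite !rV_cons_head.
by rewrite !rV_cons_tail; case: xy => _; exact.
Qed.

Lemma rV_cons_head_line (R : realType) n (h t : R) (x : 'rV[R]_n) :
  rV_cons (h *: (1 : R) + t, x) = h *: delta_mx ord0 ord0 + rV_cons (t, x).
Proof.
apply/rowP => j; rewrite [RHS]mxE.
case: (unliftP ord0 j) => [k ->|->].
  rewrite !rV_cons_tail !mxE [lift _ _ == _]eq_sym (negbTE (neq_lift _ _)).
  by rewrite andbF mulr0 add0r.
by rewrite !rV_cons_head !mxE !eqxx.
Qed.

Lemma rV_cons_tail_line (R : realType) n (h t : R) (x : 'rV[R]_n) k :
  rV_cons (t, h *: delta_mx ord0 k + x) =
  h *: delta_mx ord0 (lift ord0 k) + rV_cons (t, x).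
Proof.
apply/rowP => j; rewrite [RHS]mxE.
case: (unliftP ord0 j) => [l ->|->].
  by rewrite !rV_cons_tail !mxE (inj_eq lift_inj).
by rewrite !rV_cons_head !mxE (negbTE (neq_lift _ _)) andbF mulr0 add0r.
Qed.

(** The fundamental theorem of calculus on an interval that contains the support. *)
Lemma integral_derive_eq0 (R : realType) (G G' : R -> R) (M : R) :
  (forall t : R, is_derive t (1 : R) G (G' t)) -> continuous G' ->
  (forall t, M < `|t| -> G t = 0) ->
  (\int[lebesgue_measure]_t (G' t)%:E = 0)%E.
Proof.
move=> dG cG' G0.
have G'0 t : M < `|t| -> G' t = 0.
  move=> Mt; have [_ <-] := dG t.
  have -> : 'D_1 G t = 'D_1 (cst 0 : R -> R) t.
    apply: near_eq_derive.
    have o : open [set s : R | M < `|s|].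
      apply: (@open_comp _ _ (fun s : R => `|s|) [set r | M < r]).
        by move=> s _; exact: norm_continuous.
      exact: open_gt.
    near=> s; apply: G0; near: s.
    exact: open_nbhs_nbhs.
  exact: derive_cst.
(* The support is contained in the interior of [-N, N]. *)
pose N : R := `|M| + 1.
have N0 : 0 < N by rewrite ltr_pwDr.
have MN : M < N by rewrite ltr_pwDr// ler_norm.
transitivity (\int[lebesgue_measure]_(t in `[(- N)%R, N]) (G' t)%:E)%E.
  rewrite [RHS]integral_mkcond; apply: eq_integral => t _.
  rewrite patchE; case: ifPn => // ht; rewrite G'0//.
  apply: (lt_le_trans MN); rewrite leNgt; apply: contra ht => /ltW.
  by rewrite ler_norml inE /= in_itv.
rewrite (@continuous_FTC2 _ _ G).
- by rewrite !G0 ?normrN ?gtr0_norm// subee.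
- by rewrite gtrN.
- exact: continuous_subspaceT.
- have cG t : {for t, continuous G}.
    by apply: differentiable_continuous; apply/derivable1_diffP; case: (dG t).
  split.
  + by move=> t _; case: (dG t).
  + apply: cvg_at_right_filter; exact: cG.
  + apply: cvg_at_left_filter; exact: cG.
- by move=> t _; rewrite derive1E; case: (dG t).
Unshelve. all: by end_near.
Qed.

Lemma pd_support (R : realType) n (g : 'rV[R]_n -> R) i (D : set 'rV[R]_n) :
  open D -> (forall x, D x -> g x = 0) -> forall x, D x -> pd i g x = 0.
Proof.
move=> oD g0 x Dx; rewrite /pd.
transitivity ('D_(delta_mx ord0 i) (cst 0 : 'rV[R]_n -> R) x); last exact: derive_cst.
apply: near_eq_derive; near=> s; apply: g0; near: s.
exact: open_nbhs_nbhs.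
Unshelve. all: by end_near.
Qed.

Lemma norm_gt_open (R : realType) n (M : R) : open [set x : 'rV[R]_n | M < `|x|].
Proof.
apply: (@open_comp _ _ (fun s : 'rV[R]_n => `|s|) [set r | M < r]).
  by move=> s _; exact: norm_continuous.
exact: open_gt.
Qed.

Lemma coord_norm_le (R : realType) n (x : 'rV[R]_n) i : `|x ord0 i| <= `|x|.
Proof.
rewrite [leRHS]mx_normrE.
exact: (le_bigmax _ (fun ij : 'I_1 * 'I_n => `|x ij.1 ij.2|) (ord0, i)).
Qed.

Lemma norm_le_coord (R : realType) n (x : 'rV[R]_n) (M : R) : 0 <= M ->
  (forall i, `|x ord0 i| <= M) -> `|x| <= M.
Proof.
move=> M0 h; rewrite [leLHS]mx_normrE.
by apply: bigmax_le => // -[i j] _; rewrite (ord1 i).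
Qed.

Lemma norm_rV_cons_ge (R : realType) n t (x : 'rV[R]_n) :
  `|t| <= `|rV_cons (t, x)| /\ `|x| <= `|rV_cons (t, x)|.
Proof.
split; first by have := coord_norm_le (rV_cons (t, x)) ord0; rewrite rV_cons_head.
apply: norm_le_coord => // i.
by have := coord_norm_le (rV_cons (t, x)) (lift ord0 i); rewrite rV_cons_tail.
Qed.

Section integral_pd.
Context {R : realType}.

(** The measure on the space of dimension n + 1 is the image of a product, so the
    first coordinate can be integrated first or last. *)
Lemma integral_rV_fubini n (f : 'rV[R]_n.+1 -> R) : measurable_fun setT f ->
  (lebesgue_rV n.+1).-integrable setT (EFin \o f) ->
  (\int[lebesgue_rV n.+1]_x (f x)%:E =
   \int[lebesgue_measure]_t \int[lebesgue_rV n]_x (f (rV_cons (t, x)))%:E)%E /\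
  (\int[lebesgue_rV n.+1]_x (f x)%:E =
   \int[lebesgue_rV n]_x \int[lebesgue_measure]_t (f (rV_cons (t, x)))%:E)%E.
Proof.
move=> /measurable_EFinP mf intf.
have mcons := @measurable_rV_cons R n.
have intfc : (lebesgue_measure \x lebesgue_rV n)%E.-integrable setT
    ((EFin \o f) \o @rV_cons R n : measurableTypeR R * 'rV[R]_n -> \bar R).
  apply/integrableP; split; first exact: measurableT_comp.
  have /integrableP[_] := intf.
  rewrite /lebesgue_rV -/lebesgue_rV ge0_integral_pushforward//.
  exact: measurableT_comp.
have E : (\int[lebesgue_rV n.+1]_x (f x)%:E =
  \int[lebesgue_measure \x lebesgue_rV n]_x (f (rV_cons x))%:E)%E.
  have h := @integral_pushforward _ _ (measurableTypeR R * 'rV[R]_n)%type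
    'rV[R]_n.+1 R _ mcons (lebesgue_measure \x lebesgue_rV n)%E setT _ mf intfc
    measurableT.
  exact: h.
split; first by rewrite E -(integral12_prod_meas1 intfc).
by rewrite E -(integral21_prod_meas1 intfc).
Qed.

(** By induction on the dimension: the variable of differentiation is either the
    first coordinate, which is then integrated first, or one of the others, to
    which the induction hypothesis applies on each slice. *)
Lemma integral_pd_eq0 n (g : 'rV[R]_n -> R) i (M : R) :
  continuous g -> (forall x, derivable g x (delta_mx ord0 i)) ->
  continuous (pd i g) -> (forall x, M < `|x| -> g x = 0) ->
  (\int[lebesgue_rV n]_x (pd i g x)%:E = 0)%E.
Proof.
elim: n g i => [g []//|n ih g i cg dg cdg g0].
have dg0 := pd_support i (@norm_gt_open R n.+1 M) g0.
have mf : measurable_fun setT (pd i g).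
  by apply: continuous_measurable_rV; [exact: openT|move=> x _; exact: cdg].
have intf : (lebesgue_rV n.+1).-integrable setT (EFin \o pd i g).
  exact: continuous_support_integrable dg0.
have [E1 E2] := integral_rV_fubini mf intf.
have conth t : continuous (fun x : 'rV[R]_n => rV_cons (t, x)).
  move=> x; apply: (@continuous_comp _ _ _ (fun x : 'rV[R]_n => (t, x)) (@rV_cons R n)).
    move=> A [[P Q] /= [Pt Qx] PQ]; apply: filterS Qx => y Qy; apply: PQ.
    by split => //=; exact: nbhs_singleton.
  exact: continuous_rV_cons.
have contv x : continuous (fun t : R => @rV_cons R n (t, x)).
  move=> t; apply: (@continuous_comp _ _ _ (fun t : R => (t, x)) (@rV_cons R n)).
    move=> A [[P Q] /= [Pt Qx] PQ]; apply: filterS Pt => y Py; apply: PQ.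
    by split => //=; exact: nbhs_singleton.
  exact: continuous_rV_cons.
case: (unliftP ord0 i) => [k ik|i0].
  rewrite E1; apply: integral0_eq => t _.
  have pdE x : is_derive x (delta_mx ord0 k) (fun y => g (rV_cons (t, y)))
      (pd i g (rV_cons (t, x))).
    apply: is_derive_along (DeriveDef (dg _) erefl) => h.
    by rewrite rV_cons_tail_line ik.
  have E x : pd i g (rV_cons (t, x)) = pd k (fun y => g (rV_cons (t, y))) x.
    by case: (pdE x) => _ <-.
  under eq_integral do rewrite E; apply: ih.
  - by move=> x; apply: continuous_comp; [exact: conth|exact: cg].
  - by move=> x; case: (pdE x).
  - rewrite (_ : pd k _ = fun x => pd i g (rV_cons (t, x))).
      by move=> x; apply: continuous_comp; [exact: conth|exact: cdg].
    by apply/funext => x; rewrite E.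
  - by move=> x Mx; rewrite g0// (lt_le_trans Mx)//; case: (norm_rV_cons_ge t x).
rewrite E2; apply: integral0_eq => x _.
apply: (@integral_derive_eq0 _ (fun t => g (rV_cons (t, x))) _ M).
- move=> t; apply: is_derive_along (DeriveDef (dg _) erefl) => h.
  by rewrite rV_cons_head_line i0.
- by move=> t; apply: continuous_comp; [exact: contv|exact: cdg].
- by move=> t Mt; rewrite g0// (lt_le_trans Mt)//; case: (norm_rV_cons_ge t x).
Qed.
End integral_pd.

(** * Integration by parts and weak derivatives *)

Lemma Rintegral_support d (T : measurableType d) (R : realType)
    (m : {measure set T -> \bar R}) (D : set T) (f : T -> R) :
  (forall x, ~ D x -> f x = 0) -> \int[m]_(x in D) f x = \int[m]_x f x.
Proof.
move=> f0; rewrite Rintegral_mkcond; congr Rintegral; apply/funext => x.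
by rewrite patchE; case: ifPn => // /negP; rewrite inE => /f0.
Qed.

(** Transfers continuity from a formula valid only on an open set. *)
Lemma near_eq_continuous_at (T U : topologicalType) (f g : T -> U) x :
  (\forall y \near x, g y = f y) ->
  {for x, continuous f} -> {for x, continuous g}.
Proof.
move=> fg cf; rewrite /prop_for /continuous_at (nbhs_singleton fg).
apply: cvg_trans cf; apply: near_eq_cvg.
by apply: filterS fg => y ->.
Qed.

Section by_parts.
Context {R : realType} {n : nat} (D K : set 'rV[R]_n).
Hypotheses (cK : compact K) (KD : K `<=` D).

(** A function that is continuous only on D becomes continuous everywhere once
    multiplied by a continuous function supported in a compact part of D; its
    values outside D do not matter. *)
Lemma continuous_mul_support (f p : 'rV[R]_n -> R) :
  (forall x, D x -> {for x, continuous f}) -> continuous p ->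
  (forall x, ~ K x -> p x = 0) -> continuous (fun x => f x * p x).
Proof.
move=> cf cp p0 x; have [Kx|Kx] := pselect (K x).
  exact: (continuousM (cf _ (KD Kx)) (cp x)).
have oK : open (~` K).
  by apply: closed_openC; apply: compact_closed => //; exact: norm_hausdorff.
have nK : nbhs x (~` K) by exact: open_nbhs_nbhs.
apply: (near_eq_continuous_at (f := cst 0)); last exact: cst_continuous.
by apply: filterS nK => y Ky; rewrite /= p0 ?mulr0.
Qed.

(** The product U p extended by zero has compact support, so the integral of its
    partial derivative vanishes. *)
Lemma integral_by_parts i (U dU p : 'rV[R]_n -> R) :
  (forall x, D x -> {for x, continuous U}) ->
  (forall x, D x -> is_derive x (delta_mx ord0 i : 'rV[R]_n) U (dU x)) ->
  (forall x, D x -> {for x, continuous dU}) ->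
  Ck 1 setT p -> (forall x, ~ K x -> p x = 0) ->
  \int[lebesgue_rV n]_(x in D) (U x * pd i p x) =
  - \int[lebesgue_rV n]_(x in D) (dU x * p x).
Proof.
move=> cU hU cdU [cp /(_ i)[dp [cdp _]]] p0.
have {}cp : continuous p by move=> x; exact: cp.
have {}dp x : derivable p x (delta_mx ord0 i) by exact: dp.
have {}cdp : continuous (pd i p) by move=> x; exact: cdp.
have oK : open (~` K).
  by apply: closed_openC; apply: compact_closed => //; exact: norm_hausdorff.
have dp0 : forall x, ~ K x -> pd i p x = 0 := pd_support i oK p0.
have [M hM] := bounded_norm_le (compact_bounded cK).
have MK x : M < `|x| -> ~ K x by move=> Mx /hM; rewrite leNgt Mx.
have c1 := continuous_mul_support cU cdp dp0.
have c2 := continuous_mul_support cdU cp p0.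
have i1 := continuous_support_integrable c1 (fun x Mx =>
  etrans (congr1 (fun z => U x * z) (dp0 x (MK x Mx))) (mulr0 (U x))).
have i2 := continuous_support_integrable c2 (fun x Mx =>
  etrans (congr1 (fun z => dU x * z) (p0 x (MK x Mx))) (mulr0 (dU x))).
rewrite [LHS]Rintegral_support; last first.
  by move=> x Dx; rewrite dp0 ?mulr0// => /KD.
rewrite [in RHS]Rintegral_support; last first.
  by move=> x Dx; rewrite p0 ?mulr0// => /KD.
apply/eqP; rewrite -subr_eq0 opprK -RintegralD//.
have g0 x : ~ K x -> U x * p x = 0 by move=> Kx; rewrite p0// mulr0.
have dg x : is_derive x (delta_mx ord0 i : 'rV[R]_n) (fun x => U x * p x)
    (U x * pd i p x + dU x * p x).
  have [Kx|Kx] := pselect (K x).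
    have := @is_deriveM _ _ U p x _ _ _ (hU _ (KD Kx)) (DeriveDef (dp x) erefl).
    by rewrite [p x *: _]mulrC; exact.
  rewrite dp0// p0// !mulr0 addr0.
  apply: (@near_eq_is_derive _ _ _ (cst 0 : 'rV[R]_n -> R)).
  have nK : nbhs x (~` K) by exact: open_nbhs_nbhs.
  by apply: filterS nK => y Ky; rewrite /= p0 ?mulr0.
have pdE : pd i (fun x => U x * p x) = (fun x => U x * pd i p x + dU x * p x).
  by apply/funext => x; case: (dg x).
apply/eqP; rewrite -pdE /Rintegral (@integral_pd_eq0 _ _ _ i M)//.
- exact: (continuous_mul_support cU cp p0).
- by rewrite pdE => x; exact: (continuousD (c1 x) (c2 x)).
- by move=> x /MK/g0.
Qed.

End by_parts.

Section complex_valued.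
Context {R : realType}.
Implicit Types k t : R[i].

Lemma Re_affine k t (r : R) :
  complex.Re (k + t * r%:C%C) = complex.Re k + complex.Re t * r.
Proof. by case: k t => k1 k2 [t1 t2] /=; rewrite mulr0 subr0. Qed.

Lemma Im_affine k t (r : R) :
  complex.Im (k + t * r%:C%C) = complex.Im k + complex.Im t * r.
Proof. by case: k t => k1 k2 [t1 t2] /=; rewrite mulr0 add0r. Qed.

Lemma ReMr k (r : R) : complex.Re (k * r%:C%C) = complex.Re k * r.
Proof. by case: k => k1 k2 /=; rewrite mulr0 subr0. Qed.

Lemma ImMr k (r : R) : complex.Im (k * r%:C%C) = complex.Im k * r.
Proof. by case: k => k1 k2 /=; rewrite mulr0 add0r. Qed.

Lemma eqCE k t : complex.Re k = complex.Re t -> complex.Im k = complex.Im t -> k = t.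
Proof. by case: k t => ? ? [? ?] /= -> ->. Qed.

End complex_valued.

Lemma continuous_affine (R : realType) (T : topologicalType) (U : T -> R) a b x :
  {for x, continuous U} -> {for x, continuous (fun y => a + b * U y)}.
Proof.
move=> cU; apply: (@continuousD _ _ _ (cst (a : R)) (fun y => b * U y)).
  exact: cst_continuous.
by apply: (@continuousM _ _ (cst (b : R)) U) => //; exact: cst_continuous.
Qed.

Section weak_derivative.
Context {R : realType} {n : nat} (D : set 'rV[R]_n). 

(** Adding a constant k keeps this lemma applicable to the state itself, which does
    not vanish at the boundary; with k = 0 it serves for its derivatives. *)
Lemma weak_pd_affine i (k t : R[i]) (U : 'rV[R]_n -> R) :
  (forall x, D x -> {for x, continuous U}) ->
  (forall x, D x -> derivable U x (delta_mx ord0 i)) ->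
  (forall x, D x -> {for x, continuous (pd i U)}) ->
  weak_pd D i (fun x => k + t * (U x)%:C%C) (fun x => t * (pd i U x)%:C%C).
Proof.
move=> cU dU cdU p [/(_ 1%N) Cp [K [cK KD p0]]].
have key a b : \int[lebesgue_rV n]_(x in D) ((a + b * U x) * pd i p x) =
    - \int[lebesgue_rV n]_(x in D) ((b * pd i U x) * p x).
  apply: (integral_by_parts cK KD (U := fun x => a + b * U x)) => //.
  - by move=> x Dx; exact: continuous_affine (cU _ Dx).
  - move=> x Dx; have h := DeriveDef (dU x Dx) erefl.
    have := is_deriveD (is_derive_cst a x (delta_mx ord0 i : 'rV[R]_n)) (is_deriveZ b h).
    by rewrite add0r; exact.
  - move=> x Dx; apply: (@continuousM _ _ (cst (b : R)) (pd i U)).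
      exact: cst_continuous.
    exact: cdU.
apply: eqCE; rewrite /= ?oppr0.
  have := key (complex.Re k) (complex.Re t).
  under [X in X = _ -> _]eq_Rintegral do rewrite -Re_affine -ReMr.
  by under [X in _ = - X -> _]eq_Rintegral do rewrite -ReMr -ReMr.
have := key (complex.Im k) (complex.Im t).
under [X in X = _ -> _]eq_Rintegral do rewrite -Im_affine -ImMr.
by under [X in _ = - X -> _]eq_Rintegral do rewrite -ImMr -ImMr.
Qed.

End weak_derivative.

(** * Functions of class C^k on the whole space *)

Lemma continuous_add (R : realType) (T : topologicalType) (f g : T -> R) x :
  {for x, continuous f} -> {for x, continuous g} ->
  {for x, continuous (fun y => f y + g y)}.
Proof. by move=> cf cg; apply: (@continuousD _ _ _ f g). Qed.

(** Restricting to a line reduces this to the chain rule in one variable. The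
    inner function is only assumed to be derivable in one direction. *)
Lemma is_derive_comp (R : realType) (V : normedModType R) (phi : R -> R)
    (f : V -> R) (x v : V) (dphi df : R) :
  is_derive (f x) (1 : R) phi dphi -> is_derive x v f df ->
  is_derive x v (fun y => phi (f y)) (dphi * df).
Proof.
move=> hp hf.
have hl : is_derive (0 : R) (1 : R) (fun h : R => f (h *: v + x)) df.
  by apply: is_derive_along hf => h; rewrite [_%:A]mulr1 addr0.
have e0 : f (0 *: v + x) = f x by rewrite scale0r add0r.
rewrite -e0 in hp.
have [d1 d2] : is_derive (0 : R) (1 : R) (fun h : R => phi (f (h *: v + x))) (dphi * df).
  split.
    apply/derivable1_diffP.
    apply: (@differentiable_comp _ _ _ _ (fun h : R => f (h *: v + x)) phi).
      by apply/derivable1_diffP; case: hl.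
    by apply/derivable1_diffP; case: hp.
  rewrite -derive1E (@derive1_comp _ (fun h : R => f (h *: v + x)) phi).
  - by rewrite !derive1E; case: hp => _ ->; case: hl => _ ->.
  - by case: hl.
  - by case: hp.
apply: is_derive_along (DeriveDef d1 d2) => h.
by rewrite [_%:A]mulr1 addr0.
Qed.

Section Ck_calculus.
Context {R : realType} {n : nat}.
Local Notation E := 'rV[R]_n.
Implicit Types (f g : E -> R) (x : E) (i : 'I_n).

Lemma Ck_continuous k f : Ck k setT f -> continuous f.
Proof. by case: k => [|k] [cf _] x; exact: cf. Qed.
Arguments Ck_continuous {k f} _ _.

Lemma Ck_is_derive k f i x : Ck k.+1 setT f ->
  is_derive x (delta_mx ord0 i : E) f (pd i f x).
Proof. by move=> [_ /(_ i)[df _]]; exact: DeriveDef (df x I) erefl. Qed.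

Lemma Ck_pd k f i : Ck k.+1 setT f -> Ck k setT (pd i f).
Proof. by move=> [_ /(_ i)[]]. Qed.

(** Packages a verification of class C^(k+1) by explicit derivatives. *)
Lemma CkS k f : continuous f ->
  (forall i, exists2 df, Ck k setT df &
     forall x, is_derive x (delta_mx ord0 i : E) f (df x)) -> Ck k.+1 setT f.
Proof.
move=> cf df; split=> [x _|i]; first exact: cf.
have [g Cg fg] := df i; split=> [x _|]; first by case: (fg x).
by rewrite (_ : pd i f = g)//; apply/funext => x; case: (fg x).
Qed.

Lemma Ck_le k f : Ck k.+1 setT f -> Ck k setT f.
Proof.
elim: k f => [|k ih] f Cf; first by split => // x _; exact: (Ck_continuous Cf).
apply: CkS (Ck_continuous Cf) _ => i; exists (pd i f).
  by apply: ih; exact: Ck_pd.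
by move=> x; exact: Ck_is_derive Cf.
Qed.

Lemma Ck_cst k (c : R) : Ck k setT (fun _ : E => c).
Proof.
elim: k c => [|k ih] c; first by split => // x _; exact: cst_continuous.
apply: CkS => [x|i]; first exact: cst_continuous.
by exists (fun=> 0) => // x; exact: is_derive_cst.
Qed.

Lemma CkD k f g : Ck k setT f -> Ck k setT g -> Ck k setT (fun x => f x + g x).
Proof.
elim: k f g => [|k ih] f g Cf Cg.
  split => // x _. exact: (continuous_add (Ck_continuous Cf x) (Ck_continuous Cg x)).
apply: CkS => [x|i].
  exact: (continuous_add (Ck_continuous Cf x) (Ck_continuous Cg x)).
exists (fun x => pd i f x + pd i g x); first by apply: ih; exact: Ck_pd.
by move=> x; exact: is_deriveD (Ck_is_derive i x Cf) (Ck_is_derive i x Cg).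
Qed.

Lemma is_derive_mul f g i x (df dg : R) :
  is_derive x (delta_mx ord0 i : E) f df ->
  is_derive x (delta_mx ord0 i : E) g dg ->
  is_derive x (delta_mx ord0 i : E) (fun y => f y * g y) (df * g x + f x * dg).
Proof.
move=> hf hg; have := is_deriveM hf hg.
by rewrite addrC [g x *: _]mulrC; exact.
Qed.

Lemma CkM k f g : Ck k setT f -> Ck k setT g -> Ck k setT (fun x => f x * g x).
Proof.
elim: k f g => [|k ih] f g Cf Cg.
  by split => // x _; exact: (continuousM (Ck_continuous Cf x) (Ck_continuous Cg x)).
apply: CkS => [x|i].
  exact: (continuousM (Ck_continuous Cf x) (Ck_continuous Cg x)).
exists (fun x => pd i f x * g x + f x * pd i g x).
  by apply: CkD; apply: ih; (exact: Ck_pd || exact: Ck_le).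
by move=> x; exact: is_derive_mul (Ck_is_derive i x Cf) (Ck_is_derive i x Cg).
Qed.

Lemma Ck_prod k (I : Type) (s : seq I) (P : pred I) (F : I -> E -> R) :
  (forall j, Ck k setT (F j)) -> Ck k setT (fun x => \prod_(j <- s | P j) F j x).
Proof.
move=> CF; elim: s => [|j s ih].
  under [X in Ck _ _ X]eq_fun do rewrite big_nil; exact: Ck_cst.
under [X in Ck _ _ X]eq_fun do rewrite big_cons.
by case: (P j) => //; exact: CkM.
Qed.

Lemma Ck_coord k j : Ck k setT (fun x : E => x ord0 j).
Proof.
have cj : continuous (fun x : E => x ord0 j) by move=> x; exact: coord_continuous.
case: k => [|k]; first by split => // x _; exact: cj.
apply: CkS => // i; exists (fun=> (i == j)%:R); first exact: Ck_cst.
move=> x.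
have h : is_derive (0 : R) (1 : R) (fun h => (i == j)%:R * h + x ord0 j) ((i == j)%:R).
  have := is_deriveD (is_deriveZ (i == j)%:R (is_derive_id (0 : R) (1 : R)))
    (is_derive_cst (x ord0 j) (0 : R) (1 : R)).
  by rewrite addr0 [_ *: 1]mulr1; exact.
apply: is_derive_along h => h.
by rewrite !mxE /= [_%:A]mulr1 addr0 eq_sym mulrC.
Qed.

Lemma Ck0_comp (phi : R -> R) f : continuous phi -> Ck 0 setT f ->
  Ck 0 setT (fun x => phi (f x)).
Proof.
move=> cp Cf; split => // x _.
by apply: continuous_comp; [exact: Ck_continuous Cf _|exact: cp].
Qed.

Lemma Ck1_comp (phi dphi : R -> R) f :
  (forall t : R, is_derive t (1 : R) phi (dphi t)) -> continuous dphi ->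
  Ck 1 setT f -> Ck 1 setT (fun x => phi (f x)).
Proof.
move=> hp cp Cf.
have cphi : continuous phi.
  by move=> t; apply: differentiable_continuous; apply/derivable1_diffP; case: (hp t).
apply: CkS => [x|i].
  by apply: continuous_comp; [exact: Ck_continuous Cf _|exact: cphi].
exists (fun x => dphi (f x) * pd i f x).
  by apply: CkM; [apply: Ck0_comp => //; exact: Ck_le|exact: Ck_pd].
by move=> x; apply: is_derive_comp; exact: Ck_is_derive Cf.
Qed.

Lemma Ck2_comp (phi dphi ddphi : R -> R) f :
  (forall t : R, is_derive t (1 : R) phi (dphi t)) ->
  (forall t : R, is_derive t (1 : R) dphi (ddphi t)) -> continuous ddphi ->
  Ck 2 setT f -> Ck 2 setT (fun x => phi (f x)).
Proof.
move=> hp hdp cp Cf.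
have cphi : continuous phi.
  by move=> t; apply: differentiable_continuous; apply/derivable1_diffP; case: (hp t).
apply: CkS => [x|i].
  by apply: continuous_comp; [exact: Ck_continuous Cf _|exact: cphi].
exists (fun x => dphi (f x) * pd i f x).
  by apply: CkM; [apply: (Ck1_comp hdp) => //; exact: Ck_le|exact: Ck_pd].
by move=> x; apply: is_derive_comp; exact: Ck_is_derive Cf.
Qed.

End Ck_calculus.

Arguments Ck_continuous {R n k f} _ _.

(** * Spline profiles *)

Section splines.
Context {R : realType}.
Implicit Types s t : R.

Definition pospow k s : R := Num.max s 0 ^+ k.

Lemma pospow_nneg k s : 0 <= s -> pospow k s = s ^+ k.
Proof. by move=> s0; rewrite /pospow max_l. Qed.

Lemma pospow_le0 k s : s <= 0 -> pospow k.+1 s = 0.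
Proof. by move=> s0; rewrite /pospow max_r// expr0n. Qed.

Lemma pospow_ge0 k s : 0 <= pospow k s.
Proof. by rewrite exprn_ge0// le_max lexx orbT. Qed.

Lemma continuous_pospow k : continuous (pospow k).
Proof.
move=> s.
apply: (@continuous_comp _ _ _ (fun s : R => Num.max s 0) (fun s : R => s ^+ k)).
  by apply: continuous_max; [exact: cvg_id|exact: cvg_cst].
exact: exprn_continuous.
Qed.

(** At 0 the difference quotient is itself a positive power of the positive part,
    hence tends to 0. *)
Lemma is_derive_pospow k t :
  is_derive t (1 : R) (pospow k.+2) (k.+2%:R * pospow k.+1 t).
Proof.
have [t0|t0|t0] := ltgtP t 0.
- rewrite pospow_le0 ?ltW// mulr0.
  apply: (@near_eq_is_derive _ _ _ (cst 0 : R -> R)).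
  near=> s; rewrite pospow_le0//; apply: ltW; near: s.
  by apply: open_nbhs_nbhs; split => //; exact: open_lt.
- apply: (@near_eq_is_derive _ _ _ (fun s : R => s ^+ k.+2)).
    near=> s; rewrite pospow_nneg//; apply: ltW; near: s.
    by apply: open_nbhs_nbhs; split => //; exact: open_gt.
  rewrite pospow_nneg ?ltW//.
  split; first exact: exprn_derivable.
  by rewrite exp_derive /= [_ *: 1]mulr1.
rewrite t0 pospow_le0// mulr0.
have h : (fun h : R => h^-1 *: ((pospow k.+2 \o shift 0) (h *: (1 : R)) -
    pospow k.+2 0)) @ 0^' --> (0 : R).
  have c : (pospow k.+1 h @[h --> 0^'] --> (0 : R)).
    have := @continuous_pospow k.+1 0; rewrite /continuous_at pospow_le0//.
    exact: cvg_within_filter.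
  apply: cvg_trans c; apply: near_eq_cvg; near=> h.
  have h0 : h != 0 by near: h; exact: nbhs_dnbhs_neq.
  rewrite /= [h%:A]mulr1 addr0 [pospow k.+2 0]pospow_le0// subr0.
  have [hp|hn] := leP 0 h.
    by rewrite !pospow_nneg// [h ^+ k.+2]exprS [_ *: _]mulKf.
  by rewrite !pospow_le0 ?ltW// scaler0.
by split; [apply/cvg_ex; exists 0|exact/cvg_lim].
Unshelve. all: by end_near. Qed.

(** The linear B-spline with knots 0, 1, 2, written with truncated powers so that
    its primitives are explicit. *)
Definition hat s : R := pospow 1 s - 2 * pospow 1 (s - 1) + pospow 1 (s - 2).

(** The primitive of [hat] that is 0 on the left of 0 and 1 on the right of 2. *)
Definition ramp s : R :=
  (pospow 2 s - 2 * pospow 2 (s - 1) + pospow 2 (s - 2)) / 2.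

(** The profile of the boundary layers: its derivative is 1 - [ramp], so that it is
    the identity on the left of 0, concave, and equal to 1 on the right of 2. *)
Definition layer s : R :=
  s - (pospow 3 s - 2 * pospow 3 (s - 1) + pospow 3 (s - 2)) / 6.

Lemma is_derive_pospow_shift k (a t : R) :
  is_derive t (1 : R) (fun s => pospow k.+2 (s - a)) (k.+2%:R * pospow k.+1 (t - a)).
Proof.
have h := is_derive_pospow k (t - a).
by apply: is_derive_along h => h; rewrite addrA.
Qed.

Lemma is_derive_ramp t : is_derive t (1 : R) ramp (hat t).
Proof.
have h0 := is_derive_pospow 0 t.
have h1 := is_deriveZ 2 (is_derive_pospow_shift 0 1 t).
have h2 := is_derive_pospow_shift 0 2 t.
have h := is_deriveZ 2^-1 (is_deriveD (is_deriveB h0 h1) h2).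
apply: (is_derive_eq (is_derive_along _ h)) => [k|].
  by rewrite /ramp mulrC.
by rewrite /hat /GRing.scale/=; field.
Qed.

Lemma is_derive_layer t : is_derive t (1 : R) layer (1 - ramp t).
Proof.
have h0 := is_derive_pospow 1 t.
have h1 := is_deriveZ 2 (is_derive_pospow_shift 1 1 t).
have h2 := is_derive_pospow_shift 1 2 t.
have h := is_deriveB (is_derive_id t (1 : R))
  (is_deriveZ 6^-1 (is_deriveD (is_deriveB h0 h1) h2)).
apply: (is_derive_eq (is_derive_along _ h)) => [k|].
  by rewrite /layer mulrC.
by rewrite /ramp /GRing.scale/=; field.
Qed.

Lemma is_derive_opp_ramp t : is_derive t (1 : R) (fun s => 1 - ramp s) (- hat t).
Proof.
have := is_deriveB (is_derive_cst (1 : R) t (1 : R)) (is_derive_ramp t).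
by rewrite sub0r; exact.
Qed.

Lemma continuous_hat : continuous hat.
Proof.
have c k a : continuous (fun s : R => pospow k (s - a)).
  move=> s; apply: (@continuous_comp _ _ _ (fun s : R => s - a) (pospow k)).
    2: exact: continuous_pospow.
  by apply: continuous_add; [exact: cvg_id|exact: cst_continuous].
move=> s.
apply: (@continuous_add _ _ (fun s => pospow 1 s - 2 * pospow 1 (s - 1))
  (fun s => pospow 1 (s - 2))); last exact: c.
apply: (@continuous_add _ _ (pospow 1) (fun s => - (2 * pospow 1 (s - 1)))).
  exact: continuous_pospow.
apply: (@continuousN _ _ _ (fun s => 2 * pospow 1 (s - 1))).
apply: (@continuousM _ _ (cst (2 : R)) (fun s => pospow 1 (s - 1))); last exact: c.
exact: cst_continuous.
Qed.

Variant spline_spec s : R -> R -> R -> Prop :=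
| Spline0 of s <= 0 : spline_spec s 0 0 s
| Spline1 of 0 <= s & s <= 1 : spline_spec s s (s ^+ 2 / 2) (s - s ^+ 3 / 6)
| Spline2 of 1 <= s & s <= 2 : spline_spec s (2 - s) (1 - (2 - s) ^+ 2 / 2)
     (1 - (2 - s) ^+ 3 / 6)
| Spline3 of 2 <= s : spline_spec s 0 1 1.

Lemma splineP s : spline_spec s (hat s) (ramp s) (layer s).
Proof.
have [s0|s0] := leP s 0.
  rewrite /hat /ramp /layer !(@pospow_le0 _ s)// !(@pospow_le0 _ (s - _)); try lra.
  by rewrite !mulr0 subr0 !add0r !mul0r subr0; constructor.
have [s1|s1] := leP s 1.
  rewrite /hat /ramp /layer !(@pospow_nneg _ s) ?ltW// !(@pospow_le0 _ (s - _)); try lra.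
  by rewrite !mulr0 !subr0 !addr0; constructor; rewrite // ltW.
have [s2|s2] := leP s 2.
  rewrite /hat /ramp /layer !(@pospow_nneg _ s) ?ltW//.
  rewrite !(@pospow_nneg _ (s - 1)) ?subr_ge0 ?ltW//.
  rewrite !(@pospow_le0 _ (s - 2)) ?subr_le0// !addr0.
  have -> : s ^+ 1 - 2 * (s - 1) ^+ 1 = 2 - s by ring.
  have -> : (s ^+ 2 - 2 * (s - 1) ^+ 2) / 2 = 1 - (2 - s) ^+ 2 / 2 by field.
  have -> : s - (s ^+ 3 - 2 * (s - 1) ^+ 3) / 6 = 1 - (2 - s) ^+ 3 / 6 by field.
  by constructor; rewrite // ltW.
rewrite /hat /ramp /layer !pospow_nneg; try lra.
have -> : s ^+ 1 - 2 * (s - 1) ^+ 1 + (s - 2) ^+ 1 = 0 by ring.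
have -> : (s ^+ 2 - 2 * (s - 1) ^+ 2 + (s - 2) ^+ 2) / 2 = 1 by field.
have -> : s - (s ^+ 3 - 2 * (s - 1) ^+ 3 + (s - 2) ^+ 3) / 6 = 1 by field.
by constructor; rewrite // ltW.
Qed.

Lemma hat_itv s : 0 <= hat s <= 1.
Proof. by case: (splineP s) => *; lra. Qed.

(** This bound absorbs the factor N in N hat(N rho), once multiplied by a function
    dominated by rho. *)
Lemma hat_mul_le s : 0 <= hat s * s <= 2.
Proof. by case: (splineP s) => *; nra. Qed.

Lemma ramp_itv s : 0 <= ramp s <= 1.
Proof. by case: (splineP s) => *; nra. Qed.

Lemma layer_itv s : 0 <= s -> 0 <= layer s <= 1.
Proof.
case: (splineP s) => [u0|u0 u1|u1 u2|u2] s00; try lra.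
  have h : s ^+ 3 <= s by rewrite -[leRHS]expr1 ler_wiXn2l.
  have h' : 0 <= s ^+ 3 by rewrite exprn_ge0.
  by lra.
have h : (2 - s) ^+ 3 <= 1 by rewrite exprn_ile1//; lra.
have h' : 0 <= (2 - s) ^+ 3 by rewrite exprn_ge0//; lra.
by lra.
Qed.

Lemma layer_le s : 0 <= s -> layer s <= s.
Proof.
case: (splineP s) => [u0|u0 u1|u1 u2|u2] s00; try lra.
  have h' : 0 <= s ^+ 3 by rewrite exprn_ge0.
  by lra.
have h' : 0 <= (2 - s) ^+ 3 by rewrite exprn_ge0//; lra.
by lra.
Qed.

Lemma ramp_le0 s : s <= 0 -> ramp s = 0.
Proof.
case: (splineP s) => [//|u0 u1|u0 u1|u0] u2; [|lra|lra].
by rewrite (_ : s = 0); [field|lra].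
Qed.

Lemma hat_le0 s : s <= 0 -> hat s = 0.
Proof. by case: (splineP s) => // *; lra. Qed.

Lemma hat_ge2 s : 2 <= s -> hat s = 0.
Proof. by case: (splineP s) => // *; lra. Qed.

Lemma ramp_ge2 s : 2 <= s -> ramp s = 1.
Proof.
case: (splineP s) => [u0|u0 u1|u0 u1|//] u2; [lra|lra|].
by rewrite (_ : s = 2); [field|lra].
Qed.

Lemma layer0 : layer (0 : R) = 0.
Proof. by rewrite /layer !pospow_le0; lra. Qed.

End splines.

(** * A collar at a boundary point *)

Lemma open_bdry (R : realType) n (D : set 'rV[R]_n) x : open D ->
  bdry D x <-> closure D x /\ ~ D x.
Proof. by move=> /interior_id oD; rewrite /bdry oD. Qed.

Lemma continuous_line (R : realType) n (x v : 'rV[R]_n) :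
  continuous (fun t : R => t *: v + x).
Proof.
move=> t; apply: (@continuousD _ _ _ (fun t : R => t *: v) (cst x)).
  exact: scalel_continuous.
exact: cst_continuous.
Qed.

(** Otherwise the domain would be closed and open, and any line through one of its
    points would be contained in it. *)
Lemma bdry_nonempty (R : realType) n (D : set 'rV[R]_n) (e : 'I_n) :
  open D -> bounded_set D -> D !=set0 -> bdry D !=set0.
Proof.
move=> oD /bounded_norm_le[M hM] [x Dx]; apply: contrapT => /forallNP b0.
have cD : closed D.
  move=> y cy; apply: contrapT => Dy; apply: (b0 y).
  by apply/(open_bdry _ oD).
pose l (t : R) := t *: delta_mx ord0 e + x.
have cl : continuous l by exact: continuous_line.
have lT : l @^-1` D = setT.
  have cT : connected [set: R] by apply/connected_intervalP => ? ? ? ? ? ?.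
  apply: cT.
  - by exists 0 => /=; rewrite /l scale0r add0r.
  - exists (l @^-1` D); last by rewrite setTI.
    by apply: open_comp => // t _; exact: cl.
  - exists (l @^-1` D); last by rewrite setTI.
    rewrite -[X in closed X]setCK; apply: open_closedC.
    rewrite preimage_setC; apply: open_comp => [t _|]; first exact: cl.
    exact: closed_openC.
have : D (l (`|M| + 2 - x ord0 e)) by rewrite -[D _]/((l @^-1` D) _) lT.
move=> /hM; apply/negP; rewrite -ltNge.
apply: lt_le_trans (coord_norm_le _ e); rewrite /l !mxE !eqxx mulr1 subrK.
rewrite gtr0_norm; last by rewrite ltr_wpDl.
by rewrite (le_lt_trans (ler_norm M))// ltrDl.
Qed.

(** A local description of the domain D near a boundary point: rho is a C^2
    function, affine with slope sg = +-1 along the axis e, that defines D on the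
    compact set K, and chi is a C^2 bump supported in K. The last two fields say
    that chi decreases when one moves inwards along the axis e from any point
    where rho > 0, and strictly so on some ball. *)
Record collar (R : realType) (n : nat) (D K : set 'rV[R]_n) (e : 'I_n) (sg : R)
    (rho chi : 'rV[R]_n -> R) : Prop := Collar {
  collar_rho : Ck 2 setT rho;
  collar_chi : Ck 2 setT chi;
  collar_compact : compact K;
  collar_chi0 : forall x, ~ K x -> chi x = 0;
  collar_chi_ge0 : forall x, 0 <= chi x;
  collar_domain : forall x, K x -> (D x <-> 0 < rho x);
  collar_bdry : forall x, K x -> bdry D x -> rho x = 0;
  collar_pd_rho : forall x, pd e rho x = sg;
  collar_sg : sg * sg = 1;
  collar_pd_chi : forall x, 0 < rho x -> 0 <= - sg * pd e chi x;
  collar_inner : exists x1 r1 h c1 : _, [/\ 0 < r1, 0 < h, 0 < c1 &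
    forall x, ball (x1 : 'rV[R]_n) r1 x -> h <= rho x /\ c1 <= - sg * pd e chi x]
}.

Lemma continuous_col' (R : realType) n (e : 'I_n) :
  continuous (fun x : 'rV[R]_n => col' e x).
Proof.
move=> x A /nbhs_ballP[r /= r0 rA]; apply/nbhs_ballP; exists r => //= y [_ xy].
by apply: rA; split => // i j; rewrite !mxE; exact: xy.
Qed.

Lemma Ck_col' (R : realType) n (e : 'I_n) k (f : 'rV[R]_n.-1 -> R) :
  Ck k setT f -> Ck k setT (fun x : 'rV[R]_n => f (col' e x)).
Proof.
elim: k f => [|k ih] f Cf.
  split => // x _; apply: continuous_comp; first exact: continuous_col'.
  exact: (Ck_continuous Cf).
apply: CkS => [x|i].
  by apply: continuous_comp; [exact: continuous_col'|exact: (Ck_continuous Cf)].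
case: (unliftP e i) => [j ->|->].
  exists (fun x => pd j f (col' e x)); first by apply: ih; exact: Ck_pd.
  move=> x; apply: is_derive_along (Ck_is_derive j (col' e x) Cf) => h.
  congr f; apply/rowP => l; rewrite !mxE.
  by rewrite (inj_eq lift_inj).
exists (fun=> 0); first exact: Ck_cst.
move=> x; apply: is_derive_along (is_derive_cst (f (col' e x)) (0 : R) (1 : R)) => h.
congr f; apply/rowP => l; rewrite !mxE /=.
by rewrite eq_sym (negbTE (neq_lift _ _)) mulr0 add0r.
Qed.

Section bump.
Context {R : realType}.
Implicit Types c w : R.

Definition bump c w (s : R) : R := pospow 3 (1 - ((s - c) / w) ^+ 2).

Lemma bump_ge0 c w s : 0 <= bump c w s.
Proof. exact: pospow_ge0. Qed.

Lemma bump_center c w : bump c w c = 1.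
Proof. by rewrite /bump subrr mul0r expr0n subr0 pospow_nneg ?expr1n. Qed.

Lemma bump_out c w s : 0 < w -> w <= `|s - c| -> bump c w s = 0.
Proof.
move=> w0 ws; rewrite /bump pospow_le0// subr_le0.
rewrite -(real_normK (num_real _)) exprn_ege1//.
by rewrite normf_div (gtr0_norm w0) ler_pdivlMr// mul1r.
Qed.

Lemma is_derive_bump c w s : is_derive s (1 : R) (bump c w)
  (- (6 / w ^+ 2 * (s - c) * pospow 2 (1 - ((s - c) / w) ^+ 2))).
Proof.
have h : is_derive s (1 : R) (fun s => 1 - ((s - c) / w) ^+ 2) (- (2 / w ^+ 2 * (s - c))).
  have h1 : is_derive s (1 : R) (fun s => (s - c) * w^-1) (w^-1).
    have := is_deriveZ w^-1 (is_deriveB (is_derive_id s (1 : R))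
      (is_derive_cst c s (1 : R))).
    rewrite subr0 [_ *: 1]mulr1 => h; apply: is_derive_along h => h.
    by rewrite mulrC.
  have h2 := is_deriveB (is_derive_cst (1 : R) s (1 : R)) (is_deriveM h1 h1).
  apply: (is_derive_eq (is_derive_along _ h2)) => [k|].
    by rewrite expr2.
  rewrite sub0r /GRing.scale /=; congr (- _).
  by rewrite expr2 invfM; ring.
have := @is_derive_comp R R (pospow 3) (fun s => 1 - ((s - c) / w) ^+ 2) s 1 _ _
  (is_derive_pospow 1 _) h.
by move/is_derive_eq; apply; ring.
Qed.

End bump.

Section chart.
Context {R : realType} {n : nat} (D : set 'rV[R]_n) (x0 : 'rV[R]_n).
Variables (r s : R) (e : 'I_n) (sg : R) (gamma : 'rV[R]_n.-1 -> R).
Hypotheses (oD : open D) (bx0 : bdry D x0) (r0 : 0 < r) (sg2 : sg * sg = 1).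
Hypothesis Cg : Ck 2 setT gamma.
Let rho (x : 'rV[R]_n) := sg * (x ord0 e - gamma (col' e x)).
Hypothesis Drho : forall x, ball x0 r x -> (D x <-> 0 < rho x).
Hypotheses (s0 : 0 < s) (sr : s < r).
Hypothesis gs : forall y : 'rV[R]_n.-1, (forall j, `|y ord0 j - col' e x0 ord0 j| <= s) ->
  `|gamma y - gamma (col' e x0)| < r / 4.

Let c (j : 'I_n) := if j == e then x0 ord0 e - sg * (r / 4) else x0 ord0 j.
Let w (j : 'I_n) := if j == e then r / 2 else s.
Let chi (x : 'rV[R]_n) := \prod_j bump (c j) (w j) (x ord0 j).
Let rest (x : 'rV[R]_n) := \prod_(j | j != e) bump (c j) (w j) (x ord0 j).
Let K := [set x : 'rV[R]_n | forall j, `|x ord0 j - c j| <= w j].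

Let nsg : `|sg| = 1.
Proof.
by apply/eqP; rewrite -sqrp_eq1// expr2 -normrM sg2 normr1.
Qed.

Let w_gt0 j : 0 < w j.
Proof. by rewrite /w; case: ifP => // _; rewrite divr_gt0. Qed.

Let K_ball x : K x -> ball x0 r x.
Proof.
move=> Kx; split => // i j; rewrite (ord1 i) /ball /= distrC.
have := Kx j; rewrite /c /w; case: eqP => [->|_]; last by move/le_lt_trans; apply.
move=> h; rewrite (_ : _ - _ =
  (x ord0 e - (x0 ord0 e - sg * (r / 4))) - sg * (r / 4)); last ring.
apply: (le_lt_trans (ler_normB _ _)); rewrite normrM nsg mul1r gtr0_norm ?divr_gt0//.
move: h; move: (`|_|) => m h; have := r0; lra.
Qed.

Let K_compact : compact K.
Proof.
rewrite (_ : K = [set v | forall j, `[c j - w j, c j + w j]%classic (v ord0 j)]).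
  apply: (@rV_compact _ _ (fun j => `[c j - w j, c j + w j]%classic)) => j.
  exact: segment_compact.
by apply/seteqP; split => x /= h j; have := h j; rewrite /= in_itv /= ler_distl.
Qed.

Let chi0 x : ~ K x -> chi x = 0.
Proof.
move=> /existsNP[j /negP]; rewrite -ltNge => h.
by rewrite /chi (bigD1 j)//= bump_out ?mul0r// ltW.
Qed.

Let Ck_bump j : Ck 2 setT (fun x : 'rV[R]_n => bump (c j) (w j) (x ord0 j)).
Proof.
apply: (Ck2_comp (is_derive_pospow 1)).
- move=> t; exact: (is_deriveZ 3 (is_derive_pospow 0 t)).
- move=> t; apply: (@continuousM _ _ (cst (3 : R)) (fun t => 2 * pospow 1 t)).
    exact: cst_continuous.
  apply: (@continuousM _ _ (cst (2 : R)) (pospow 1)); last exact: continuous_pospow.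
  exact: cst_continuous.
have Cq : Ck 2 setT (fun x : 'rV[R]_n => (x ord0 j + - c j) * (w j)^-1).
  by apply: CkM; [apply: CkD; [exact: Ck_coord|exact: Ck_cst]|exact: Ck_cst].
have := CkD (@Ck_cst R n 2 1) (CkM (@Ck_cst R n 2 (-1)) (CkM Cq Cq)).
rewrite (_ : (fun x => _) = (fun x : 'rV[R]_n => 1 - ((x ord0 j - c j) / w j) ^+ 2))//.
by apply/funext => x; rewrite mulN1r expr2.
Qed.

Let Ck_chi : Ck 2 setT chi.
Proof. exact: Ck_prod. Qed.

Let Ck_rho : Ck 2 setT rho.
Proof.
apply: CkM; first exact: Ck_cst.
apply: CkD; first exact: Ck_coord.
rewrite (_ : (fun x => _) = (fun x : 'rV[R]_n => -1 * gamma (col' e x))).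
  by apply: CkM; [exact: Ck_cst|exact: Ck_col'].
by apply/funext => x; rewrite mulN1r.
Qed.

Let col'_line (x : 'rV[R]_n) (h : R) : col' e (h *: delta_mx ord0 e + x) = col' e x.
Proof.
by apply/rowP => l; rewrite !mxE /= eq_sym (negbTE (neq_lift _ _)) mulr0 add0r.
Qed.

Let coord_line (x : 'rV[R]_n) (h : R) :
  (h *: delta_mx ord0 e + x : 'rV[R]_n) ord0 e = h + x ord0 e.
Proof. by rewrite !mxE !eqxx mulr1. Qed.

Let coord_line_neq (x : 'rV[R]_n) (h : R) j : j != e ->
  (h *: delta_mx ord0 e + x : 'rV[R]_n) ord0 j = x ord0 j.
Proof. by move=> je; rewrite !mxE eqxx (negbTE je) mulr0 add0r. Qed.

Let pd_rho x : pd e rho x = sg.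
Proof.
have h1 := is_deriveZ sg (is_deriveD (is_derive_id (0 : R) (1 : R))
  (is_derive_cst (x ord0 e - gamma (col' e x)) (0 : R) (1 : R))).
have h : is_derive x (delta_mx ord0 e : 'rV[R]_n) rho (sg *: (1 + 0)).
  apply: is_derive_along h1 => h.
  by rewrite /rho col'_line coord_line [h%:A]mulr1 addr0 -addrA.
by case: h => _; rewrite /pd => ->; rewrite addr0 [_ *: _]mulr1.
Qed.

Let pd_chi x : pd e chi x =
  - (6 / (r / 2) ^+ 2 * (x ord0 e - c e) *
     pospow 2 (1 - ((x ord0 e - c e) / (r / 2)) ^+ 2)) * rest x.
Proof.
have we : w e = r / 2 by rewrite /w eqxx.
have h1 : is_derive x (delta_mx ord0 e : 'rV[R]_n) rest 0.
  apply: is_derive_along (is_derive_cst (rest x) (0 : R) (1 : R)) => h.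
  by rewrite /rest; apply: eq_bigr => j je; rewrite coord_line_neq.
have h2 := is_derive_bump (c e) (w e) (x ord0 e).
have {}h2 : is_derive x (delta_mx ord0 e : 'rV[R]_n)
    (fun x => bump (c e) (w e) (x ord0 e))
    (- (6 / w e ^+ 2 * (x ord0 e - c e) *
        pospow 2 (1 - ((x ord0 e - c e) / w e) ^+ 2))).
  by apply: is_derive_along h2 => h; rewrite coord_line [_%:A]mulr1.
have := is_derive_mul h2 h1.
rewrite mulr0 addr0 we => h3.
have -> : chi = fun x => bump (c e) (r / 2) (x ord0 e) * rest x.
  by apply/funext => y; rewrite /chi (bigD1 e)//= we.
by case: h3.
Qed.

Let bdry_ball x : ball x0 r x -> bdry D x -> rho x = 0.
Proof.
move=> xr /(open_bdry _ oD)[cx Dx].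
have le0 : rho x <= 0 by rewrite leNgt; apply/negP => /(Drho xr).2.
apply/eqP; rewrite eq_le le0 /= leNgt; apply/negP => lt0.
have [y [Dy [yr ylt]]] : D `&` (ball x0 r `&` rho @^-1` [set z | z < 0]) !=set0.
  apply: cx; apply: filterI.
    by apply: open_nbhs_nbhs; split => //; exact: ball_open.
  apply: (Ck_continuous Ck_rho x).
  by apply: open_nbhs_nbhs; split => //; exact: open_lt.
by have /(_ Dy) := (Drho yr).1; rewrite ltNge (ltW ylt).
Qed.

Let col'_K x : K x -> `|gamma (col' e x) - gamma (col' e x0)| < r / 4.
Proof.
move=> Kx; apply: gs => j; rewrite !mxE.
by have := Kx (lift e j); rewrite /c /w eq_sym (negbTE (neq_lift _ _)).
Qed.

Let rho0 : gamma (col' e x0) = x0 ord0 e.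
Proof.
have := bdry_ball (ballxx _ r0) bx0; rewrite /rho => /(congr1 (fun z => sg * z)).
by rewrite mulrA sg2 mul1r mulr0 => /subr0_eq.
Qed.

Let rest_ge0 x : 0 <= rest x.
Proof. by apply: prodr_ge0 => j _; exact: bump_ge0. Qed.

Let pd_chi_ge0 x : 0 < rho x -> 0 <= - sg * pd e chi x.
Proof.
move=> rx; have [Kx|nKx] := pselect (K x); last first.
  have oK : open (~` K).
    by apply: closed_openC; apply: compact_closed => //; exact: norm_hausdorff.
  by rewrite (pd_support e oK chi0 nKx) mulr0.
have h : 0 <= sg * (x ord0 e - c e).
  have : - (r / 4) <= sg * (gamma (col' e x) - gamma (col' e x0)).
    have : `|sg * (gamma (col' e x) - gamma (col' e x0))| <= r / 4.
      by rewrite normrM nsg mul1r ltW// col'_K.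
    by rewrite ler_norml => /andP[].
  rewrite rho0 /c eqxx.
  have -> : sg * (x ord0 e - (x0 ord0 e - sg * (r / 4))) =
      sg * (x ord0 e - x0 ord0 e) + sg * sg * (r / 4) by ring.
  rewrite sg2 mul1r; move: rx; rewrite /rho; lra.
rewrite pd_chi (_ : - sg * _ = 6 / (r / 2) ^+ 2 * (sg * (x ord0 e - c e)) *
     pospow 2 (1 - ((x ord0 e - c e) / (r / 2)) ^+ 2) * rest x); last ring.
have p : 0 < 6 / (r / 2) ^+ 2 by rewrite divr_gt0// exprn_gt0// divr_gt0.
apply: mulr_ge0 => //; apply: mulr_ge0; last exact: pospow_ge0.
by apply: mulr_ge0 => //; exact: ltW.
Qed.

Let inner : exists x1 r1 h c1 : _, [/\ 0 < r1, 0 < h, 0 < c1 &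
    forall x, ball (x1 : 'rV[R]_n) r1 x -> h <= rho x /\ c1 <= - sg * pd e chi x].
Proof.
(* A point at height r / 8 inside D above x0, hence at distance 3 r / 8 < r / 2 from
   the centre of the bump along the axis e. *)
pose x1 : 'rV[R]_n := (sg * (r / 8)) *: delta_mx ord0 e + x0.
have rx1 : rho x1 = r / 8.
  by rewrite /rho col'_line coord_line rho0 addrK mulrA sg2 mul1r.
have px1 : 0 < - sg * pd e chi x1.
  have xc : x1 ord0 e - c e = sg * (r * 3 / 8).
    by rewrite coord_line /c eqxx; field.
  have rest1 : rest x1 = 1.
    rewrite /rest big1// => j je; rewrite coord_line_neq// /c (negbTE je).
    exact: bump_center.
  rewrite pd_chi xc rest1 (_ : sg * (r * 3 / 8) / (r / 2) = sg * (3 / 4)); last first.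
    by field; rewrite gt_eqF.
  have -> : (sg * (3 / 4)) ^+ 2 = 9 / 16 by rewrite exprMn [sg ^+ 2]expr2 sg2; field.
  rewrite pospow_nneg; last lra.
  rewrite (_ : - sg * _ =
    (sg * sg) * (6 / (r / 2) ^+ 2 * (r * 3 / 8) * (1 - 9 / 16) ^+ 2)); last ring.
  have p : 0 < 6 / (r / 2) ^+ 2 by rewrite divr_gt0// exprn_gt0// divr_gt0.
  rewrite sg2 mul1r mulr_gt0//; last by rewrite exprn_gt0//; lra.
  by rewrite mulr_gt0//; have := r0; lra.
pose g x := - sg * pd e chi x.
have cg : {for x1, continuous g}.
  apply: (@continuousM _ _ (cst (- sg)) (pd e chi)); first exact: cst_continuous.
  exact: (Ck_continuous (Ck_pd e Ck_chi)).
have n1 : nbhs x1 (rho @^-1` [set z | r / 16 < z]).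
  apply: (Ck_continuous Ck_rho x1); apply: open_nbhs_nbhs; split; first exact: open_gt.
  by rewrite /= rx1; have := r0; lra.
have n2 : nbhs x1 (g @^-1` [set z | g x1 / 2 < z]).
  apply: cg; apply: open_nbhs_nbhs; split; first exact: open_gt.
  by rewrite /= ltr_pdivrMr// ltr_pMr// ltr1n.
have /nbhs_ballP[r1 /= r10 hr1] : nbhs x1
    ((rho @^-1` [set z | r / 16 < z]) `&` (g @^-1` [set z | g x1 / 2 < z])).
  exact: filterI.
exists x1, r1, (r / 16), (g x1 / 2); split => //; first by rewrite divr_gt0.
  by rewrite divr_gt0.
by move=> x /hr1[/ltW ? /ltW ?].
Qed.

Lemma chart_collar : collar D K e sg rho chi.
Proof.
split => //.
- by move=> x; apply: prodr_ge0 => j _; exact: bump_ge0.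
- by move=> x /K_ball/Drho.
- by move=> x /K_ball; exact: bdry_ball.
Qed.

End chart.

(** The bump is wide (r / 2) along the axis e and centred at distance r / 4 outside
    the domain, so that it decreases towards the inside all along the boundary;
    in the other directions it is so narrow that the graph of gamma varies by
    less than r / 4 over it. *)
Lemma boundary_collar (R : realType) n (D : set 'rV[R]_n) (e0 : 'I_n) :
  open D -> bounded_set D -> D !=set0 -> C2_smooth D ->
  exists K e sg rho chi, @collar R n D K e sg rho chi.
Proof.
move=> oD bD D0 /[dup] sD; have [x0 bx0] := bdry_nonempty e0 oD bD D0.
move=> /(_ _ bx0)[r [e [up [gamma [r0 Cg hD]]]]].
pose sg : R := if up then 1 else -1.
have sg2 : sg * sg = 1 by rewrite /sg; case: (up); rewrite ?mulrNN mulr1.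
have Drho x : ball x0 r x -> (D x <-> 0 < sg * (x ord0 e - gamma (col' e x))).
  move=> /hD ->; rewrite /sg; case: (up); first by rewrite mul1r subr_gt0.
  by rewrite mulN1r opprB subr_gt0.
have cg := Ck_continuous Cg (col' e x0).
have : nbhs (col' e x0) (gamma @^-1` ball (gamma (col' e x0)) (r / 4)).
  by apply: cg; apply: nbhsx_ballx; rewrite divr_gt0.
move=> /nbhs_ballP[s /= s0 hs].
(* The half is taken because the support of the bump is closed. *)
pose s1 := Num.min s r / 2.
have s10 : 0 < s1 by rewrite divr_gt0// lt_min s0.
have s1r : s1 < r.
  rewrite /s1 ltr_pdivrMr// mulr_natr mulr2n (le_lt_trans (_ : _ <= r))//.
    by rewrite ge_min lexx orbT.
  by rewrite ltrDl.
have s1s : s1 < s.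
  rewrite /s1 ltr_pdivrMr// mulr_natr mulr2n (le_lt_trans (_ : _ <= s))//.
    by rewrite ge_min lexx.
  by rewrite ltrDl.
do 5 eexists; apply: (@chart_collar _ _ D x0 r s1 e sg gamma) => //.
move=> y hy; have : ball (col' e x0) s y.
  split => // i j; rewrite (ord1 i) /ball /= distrC.
  exact: le_lt_trans (hy j) s1s.
by move=> /hs; rewrite /ball /= distrC.
Qed.

(** * Uniformly bounded functions and null sequences *)

Lemma near_norm_le (R : realType) (u : nat -> R) (eps : R) :
  u N @[N --> \oo] --> (0 : R) -> 0 < eps -> \forall N \near \oo, `|u N| <= eps.
Proof. by move=> cu e0; exact: (@cvgr0_norm_le R R nat \oo _ u cu eps e0). Qed.

Section bounded_functions.
Context d (T : measurableType d) (R : realType) (D : set T).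
Hypothesis mD : measurable D.
Implicit Types (f g : T -> R) (F G : nat -> T -> R).

(** The regularity under which all integrals over a set of finite measure make
    sense and are linear. *)
Definition bdd f := measurable_fun D f /\
  exists M : R, forall x, D x -> `|f x| <= M.

(** The hypotheses of the bounded convergence theorem with limit 0. *)
Definition negl F := [/\ forall N, measurable_fun D (F N),
  exists M : R, forall N x, D x -> `|F N x| <= M &
  forall x, D x -> F N x @[N --> \oo] --> (0 : R)].

Lemma bdd_cst (c : R) : bdd (fun=> c).
Proof. by split; [exact: measurable_cst|exists `|c|]. Qed.

Lemma bddD f g : bdd f -> bdd g -> bdd (fun x => f x + g x).
Proof.
move=> [mf [M hM]] [mg [L hL]]; split; first exact: measurable_funD.
exists (M + L) => x Dx; apply: le_trans (ler_normD _ _) _.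
by apply: lerD; [exact: hM|exact: hL].
Qed.

Lemma bddM f g : bdd f -> bdd g -> bdd (fun x => f x * g x).
Proof.
move=> [mf [M hM]] [mg [L hL]]; split; first exact: measurable_funM.
exists (M * L) => x Dx; rewrite normrM.
by apply: ler_pM => //; [exact: hM|exact: hL].
Qed.

Lemma bddZ (c : R) f : bdd f -> bdd (fun x => c * f x).
Proof. by move=> bf; apply: bddM => //; exact: bdd_cst. Qed.

Lemma bdd_eq f g : (forall x, D x -> f x = g x) -> bdd f -> bdd g.
Proof.
move=> fg [mf [M hM]]; split; last by exists M => x Dx; rewrite -fg// hM.
by apply: eq_measurable_fun mf => x /set_mem; exact: fg.
Qed.

Lemma bdd_sum (I : Type) (s : seq I) (P : pred I) (f : I -> T -> R) :
  (forall i, bdd (f i)) -> bdd (fun x => \sum_(i <- s | P i) f i x).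
Proof.
move=> bf; elim: s => [|i s ih].
  by apply: bdd_eq (bdd_cst 0) => x _; rewrite big_nil.
under [X in bdd X]eq_fun do rewrite big_cons.
by case: (P i) => //; exact: bddD.
Qed.

Lemma negl_bdd F N : negl F -> bdd (F N).
Proof. by move=> [mF [M hM] _]; split => //; exists M => x; exact: hM. Qed.

Lemma negl_eq F G : (forall N x, D x -> F N x = G N x) -> negl F -> negl G.
Proof.
move=> FG [mF [M hM] cF]; split.
- by move=> N; apply: eq_measurable_fun (mF N) => x /set_mem; exact: FG.
- by exists M => N x Dx; rewrite -FG// hM.
- by move=> x Dx; have := cF x Dx; under eq_fun do rewrite FG//.
Qed.

Lemma negl0 : negl (fun _ _ => 0).
Proof.
split; [by move=> _; exact: measurable_cst|by exists 0 => _ x _; rewrite normr0|].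
by move=> x _; exact: cvg_cst.
Qed.

Lemma neglD F G : negl F -> negl G -> negl (fun N x => F N x + G N x).
Proof.
move=> nF nG; split.
- by move=> N; case: (bddD (negl_bdd N nF) (negl_bdd N nG)).
- have [_ [M hM] _] := nF; have [_ [L hL] _] := nG.
  exists (M + L) => N x Dx; apply: le_trans (ler_normD _ _) _.
  by apply: lerD; [exact: hM|exact: hL].
- move=> x Dx; rewrite -[X in _ --> X]addr0.
  by apply: cvgD; [case: nF => _ _|case: nG => _ _]; exact.
Qed.

Lemma neglM F G : negl F -> (forall N, measurable_fun D (G N)) ->
  (exists M : R, forall N x, D x -> `|G N x| <= M) ->
  negl (fun N x => F N x * G N x).
Proof.
move=> [mF [M hM] cF] mG [L hL]; split.
- by move=> N; exact: measurable_funM.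
- exists (M * L) => N x Dx; rewrite normrM.
  by apply: ler_pM => //; [exact: hM|exact: hL].
- move=> x Dx; apply/norm_cvg0P.
  apply: (@squeeze_cvgr _ _ _ _ (fun=> 0) (fun N => `|F N x| * L)).
  + by apply: nearW => N; rewrite normr_ge0 /= normrM ler_wpM2l// hL.
  + exact: cvg_cst.
  + rewrite -[X in _ --> X](mul0r L); apply: cvgM; last exact: cvg_cst.
    by apply/norm_cvg0P; exact: cF.
Qed.

Lemma neglMl f F : bdd f -> negl F -> negl (fun N x => f x * F N x).
Proof.
move=> [mf [M hM]] nF; apply: negl_eq (neglM nF (fun=> mf) _) => [N x _|].
  by rewrite mulrC.
by exists M => _ x; exact: hM.
Qed.

Lemma negl_sum (I : Type) (s : seq I) (P : pred I) (F : I -> nat -> T -> R) :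
  (forall i, negl (F i)) -> negl (fun N x => \sum_(i <- s | P i) F i N x).
Proof.
move=> nF; elim: s => [|i s ih].
  by apply: negl_eq negl0 => N x _; rewrite big_nil.
case Pi: (P i).
  by apply: negl_eq (neglD (nF i) ih) => N x _; rewrite big_cons Pi.
by apply: negl_eq ih => N x _; rewrite big_cons Pi.
Qed.

Variable m : {measure set T -> \bar R}.
Hypothesis mDoo : (m D < +oo)%E.

Lemma bdd_integrable f : bdd f -> m.-integrable D (EFin \o f).
Proof.
move=> [mf [M hM]]; apply: measurable_bounded_integrable => //.
exists M; split; first by rewrite num_real.
by move=> L ML x Dx; apply: le_trans (hM _ Dx) (ltW ML).
Qed.

Lemma bdd_integralE f : bdd f ->
  (\int[m]_(x in D) (f x)%:E)%E = (\int[m]_(x in D) f x)%:E.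
Proof.
move=> bf; rewrite fineK//; apply: integrable_fin_num => //.
exact: bdd_integrable.
Qed.

Lemma bdd_RintegralD f g : bdd f -> bdd g ->
  \int[m]_(x in D) (f x + g x) = \int[m]_(x in D) f x + \int[m]_(x in D) g x.
Proof. by move=> bf bg; rewrite RintegralD//; exact: bdd_integrable. Qed.

Lemma bdd_RintegralZ (c : R) f : bdd f ->
  \int[m]_(x in D) (c * f x) = c * \int[m]_(x in D) f x.
Proof. by move=> bf; rewrite RintegralZl//; exact: bdd_integrable. Qed.

Lemma bdd_le_Rintegral f g : bdd f -> bdd g -> (forall x, D x -> f x <= g x) ->
  \int[m]_(x in D) f x <= \int[m]_(x in D) g x.
Proof. by move=> bf bg fg; apply: le_Rintegral => //; exact: bdd_integrable. Qed.

Lemma negl_cvg F : negl F -> \int[m]_(x in D) F N x @[N --> \oo] --> (0 : R).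
Proof.
move=> nF; have [mF [M hM] cF] := nF.
have h1 N : measurable_fun D (fun x => (F N x)%:E).
  by apply/measurable_EFinP; exact: mF.
have h2 : measurable_fun D (fun _ : T => 0%E : \bar R) by exact: measurable_cst.
have h3 : {ae m, forall x, D x -> (F N x)%:E @[N --> \oo] --> (0%E : \bar R)}.
  by apply: aeW => x Dx; apply/fine_cvgP; split; [exact: nearW|exact: cF].
have h4 : m.-integrable D (EFin \o (fun=> M)) by exact: (bdd_integrable (bdd_cst M)).
have h5 : {ae m, forall x N, D x -> (`|(F N x)%:E| <= (EFin \o (fun=> M)) x)%E}.
  by apply: aeW => x N Dx; rewrite /= lee_fin hM.
have [_ _] := dominated_convergence mD h1 h2 h3 h4 h5.
by rewrite integral0 => /fine_cvgP[_]; exact.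
Qed.

End bounded_functions.

(** * Boundary layers *)

Definition div_grad (R : realType) n (a : 'rV[R]_n -> 'M[R]_n) (u : 'rV[R]_n -> R)
    (x : 'rV[R]_n) : R :=
  \sum_i \sum_j pd i (fun y => a y i j * pd j u y) x.

Section layers.
Context {R : realType} {n : nat} (Om K : set 'rV[R]_n) (a : 'rV[R]_n -> 'M[R]_n).
Variables (e : 'I_n) (sg : R) (rho chi : 'rV[R]_n -> R).
Hypotheses (oO : open Om) (bO : bounded_set Om).
Hypothesis Ca : forall i j, C1_closure Om (fun x => a x i j).
Hypothesis Col : collar Om K e sg rho chi.
Local Notation leb := (lebesgue_rV n).

Lemma open_bounded_lt_oo : (leb Om < +oo)%E.
Proof. by apply: bounded_lebesgue_rV => //; exact: open_measurable_rV. Qed.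

Lemma Ck_bdd k f : Ck k setT f -> bdd Om f.
Proof.
move=> Cf; have cf := Ck_continuous Cf; split.
  by apply: continuous_measurable_rV => // x _; exact: cf.
have [M hM] := bounded_norm_le bO.
have [N hN] := compact_bounded_fun (@norm_le_compact R n M) (continuous_subspaceT cf).
by exists N => x /hM/hN.
Qed.

Lemma extends_bdd f : (forall x, Om x -> {for x, continuous f}) ->
  extends_to_closure Om f -> bdd Om f.
Proof.
move=> cf [F [cF Ff]]; split; first exact: continuous_measurable_rV.
have [M hM] := bounded_norm_le bO.
have cO : compact (closure Om).
  apply: (@subclosed_compact _ _ [set x | `|x| <= M]).
  - exact: closed_closure.
  - exact: norm_le_compact.
  - move=> x cx; apply: contrapT => /negP; rewrite -ltNge => Mx.
    have [y [/hM yM]] := cx _ (open_nbhs_nbhs (conj (@norm_gt_open R n M) Mx)).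
    by rewrite /= ltNge yM.
have [N hN] := compact_bounded_fun cO cF.
by exists N => x Ox; rewrite -Ff// hN//; exact: subset_closure.
Qed.

Lemma coef_bdd i j : bdd Om (fun x => a x i j).
Proof. by have [[ca _] ea _] := Ca i j; exact: extends_bdd. Qed.

Lemma pd_coef_bdd k i j : bdd Om (pd k (fun x => a x i j)).
Proof.
have [[_ /(_ k)[_ [ca _]]] _ ea] := Ca i j.
by apply: extends_bdd => //; exact: ea.
Qed.

Lemma is_derive_flux i j k x (u : 'rV[R]_n -> R) : Ck 1 setT u -> Om x ->
  is_derive x (delta_mx ord0 k : 'rV[R]_n) (fun y => a y i j * u y)
    (pd k (fun y => a y i j) x * u x + a x i j * pd k u x).
Proof.
move=> Cu Ox; have [[_ /(_ k)[da _]] _ _] := Ca i j.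
exact: is_derive_mul (DeriveDef (da _ Ox) erefl) (Ck_is_derive k x Cu).
Qed.

Lemma pd_flux i j k x (u : 'rV[R]_n -> R) : Ck 1 setT u -> Om x ->
  pd k (fun y => a y i j * u y) x =
  pd k (fun y => a y i j) x * u x + a x i j * pd k u x.
Proof. by move=> Cu Ox; case: (is_derive_flux i j k Cu Ox). Qed.

Lemma div_gradE u x : Ck 2 setT u -> Om x ->
  div_grad a u x = \sum_i \sum_j
    (pd i (fun y => a y i j) x * pd j u x + a x i j * pd i (pd j u) x).
Proof.
move=> Cu Ox; apply: eq_bigr => i _; apply: eq_bigr => j _.
by rewrite pd_flux//; exact: Ck_pd.
Qed.

Lemma div_grad_bdd u : Ck 2 setT u -> bdd Om (div_grad a u).
Proof.
move=> Cu; apply: (@bdd_eq _ _ _ _ (fun x => \sum_i \sum_j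
    (pd i (fun y => a y i j) x * pd j u x + a x i j * pd i (pd j u) x))).
  by move=> x Ox; rewrite div_gradE.
apply: bdd_sum => i; apply: bdd_sum => j; apply: bddD; apply: bddM.
- exact: pd_coef_bdd.
- exact: Ck_bdd (Ck_pd j Cu).
- exact: coef_bdd.
- exact: Ck_bdd (Ck_pd i (Ck_pd j Cu)).
Qed.

Lemma div_gradDZ (k : R) u v x : Ck 2 setT u -> Ck 2 setT v -> Om x ->
  div_grad a (fun y => u y + k * v y) x = div_grad a u x + k * div_grad a v x.
Proof.
move=> Cu Cv Ox.
have pdL m (f g : 'rV[R]_n -> R) i : Ck m.+1 setT f -> Ck m.+1 setT g ->
    pd i (fun y => f y + k * g y) = fun y => pd i f y + k * pd i g y.
  move=> Cf Cg; apply/funext => y.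
  by have [] := is_deriveD (Ck_is_derive i y Cf) (is_deriveZ k (Ck_is_derive i y Cg)).
have Ckv : Ck 2 setT (fun y => k * v y) by exact: (CkM (@Ck_cst R n 2 k) Cv).
rewrite [LHS](div_gradE (CkD Cu Ckv) Ox) (div_gradE Cu Ox) (div_gradE Cv Ox).
rewrite mulr_sumr -big_split; apply: eq_bigr => i _ /=.
rewrite mulr_sumr -big_split; apply: eq_bigr => j _ /=.
rewrite (pdL 1%N u v j Cu Cv) (pdL 0%N _ _ i (Ck_pd j Cu) (Ck_pd j Cv)).
by rewrite !mulrDr !(mulrCA _ k) addrACA.
Qed.

(** Conditions only on positive numbers, as rho is positive on the part of the
    domain that is seen by the bump. *)
Definition vanishing_profile (phi : nat -> R -> R) :=
  [/\ forall N, continuous (phi N),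
   exists C : R, forall N s, 0 < s -> `|phi N s| <= C &
   forall s, 0 < s -> phi N s @[N --> \oo] --> (0 : R)].

(** Outside K the factor A vanishes, and on the part of K in the domain rho is
    positive, so that only the values of the profile on positive numbers
    matter. *)
Lemma profile_negl (A : 'rV[R]_n -> R) phi :
  bdd Om A -> (forall x, ~ K x -> A x = 0) -> vanishing_profile phi ->
  negl Om (fun N x => A x * phi N (rho x)).
Proof.
move=> bA A0 [cp [C hC] p0].
have rho_gt0 x : K x -> Om x -> 0 < rho x by move=> Kx /(collar_domain Col Kx).
split.
- move=> N; apply: measurable_funM; first by case: bA.
  apply: continuous_measurable_rV => // x _.
  by apply: continuous_comp; [exact: (Ck_continuous (collar_rho Col))|exact: cp].
- have [_ [M hM]] := bA; exists (M * C) => N x Ox.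
  have [Kx|nKx] := pselect (K x); last first.
    rewrite A0// mul0r normr0.
    have M0 : 0 <= M by apply: le_trans (hM _ Ox).
    by apply: mulr_ge0 => //; apply: le_trans (hC 0%N 1 ltr01).
  by rewrite normrM; apply: ler_pM => //; [exact: hM|apply: hC; exact: rho_gt0].
- move=> x Ox; have [Kx|nKx] := pselect (K x); last first.
    by under eq_fun do rewrite A0// mul0r; exact: cvg_cst.
  rewrite -[X in _ --> X](mulr0 (A x)).
  by apply: cvgM; [exact: cvg_cst|apply: p0; exact: rho_gt0].
Qed.

Lemma continuous_rescaled (f : R -> R) (k : R) : continuous f ->
  continuous (fun s => f (k * s)).
Proof.
move=> cf s; apply: (@continuous_comp _ _ _ (fun s : R => k * s) f); last exact: cf.
by apply: (@continuousM _ _ (cst k) id); [exact: cst_continuous|exact: cvg_id].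
Qed.

Lemma continuous_mul (f g : R -> R) : continuous f -> continuous g ->
  continuous (fun s => f s * g s).
Proof. by move=> cf cg s; apply: (@continuousM _ _ f g); [exact: cf|exact: cg]. Qed.

Lemma continuous_scale (k : R) (f : R -> R) : continuous f ->
  continuous (fun s => k * f s).
Proof.
by move=> cf s; apply: (@continuousM _ _ (cst k) f); [exact: cst_continuous|exact: cf].
Qed.

Lemma continuous_layer : continuous (@layer R).
Proof.
move=> s; apply: differentiable_continuous; apply/derivable1_diffP.
by case: (is_derive_layer s).
Qed.

Lemma continuous_ramp : continuous (@ramp R).
Proof.
move=> s; apply: differentiable_continuous; apply/derivable1_diffP.
by case: (is_derive_ramp s).
Qed.

Lemma near_rescaled_ge2 (s : R) : 0 < s -> \forall N \near \oo, 2 <= N.+1%:R * s.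
Proof.
move=> s0; near=> N; rewrite -ler_pdivrMr//.
apply: (@le_trans _ _ N%:R); last by rewrite ler_nat.
by near: N; exact: nbhs_infty_ger.
Unshelve. all: by end_near. Qed.

Lemma profile_layer : vanishing_profile (fun N s => N.+1%:R^-1 * layer (N.+1%:R * s)).
Proof.
have bd N s : 0 < s -> `|N.+1%:R^-1 * layer (N.+1%:R * s)| <= N.+1%:R^-1 :> R.
  move=> s0; have /andP[l0 l1] := layer_itv (mulr_ge0 (ler0n R N.+1) (ltW s0)).
  by rewrite ger0_norm ?mulr_ge0// ler_piMr.
split.
- by move=> N; apply: continuous_scale; apply: continuous_rescaled; exact: continuous_layer.
- by exists 1 => N s /(bd N)/le_trans; apply; rewrite invf_le1// ler1n.
- move=> s s0; apply/norm_cvg0P.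
  apply: (@squeeze_cvgr _ _ _ _ (cst 0) (@harmonic R)).
  - by apply: nearW => N; rewrite normr_ge0 /=; exact: bd.
  - exact: cvg_cst.
  - exact: cvg_harmonic.
Qed.

Lemma profile_ramp : vanishing_profile (fun N s => 1 - ramp (N.+1%:R * s)).
Proof.
split.
- move=> N; apply: (@continuous_rescaled (fun s => 1 - ramp s)) => s.
  apply: differentiable_continuous; apply/derivable1_diffP.
  by case: (is_derive_opp_ramp s).
- exists 1 => N s s0; have /andP[? ?] := ramp_itv (N.+1%:R * s).
  by rewrite ger0_norm; lra.
- move=> s s0; apply: (@cvg_trans _ ((fun=> 0 : R) @ \oo)); last exact: cvg_cst.
  apply: near_eq_cvg; near=> N; rewrite ramp_ge2 ?subrr//.
  by near: N; exact: near_rescaled_ge2.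
Unshelve. all: by end_near. Qed.

(** The factor N.+1 is compensated by layer(s) <= s and hat(s) s <= 2, whatever the
    scale of the layer; both a fixed scale and the scale N itself are needed. *)
Lemma profile_hat_layer (k : nat -> nat) : vanishing_profile (fun N s =>
  N.+1%:R * hat (N.+1%:R * s) * ((k N).+1%:R^-1 * layer ((k N).+1%:R * s))).
Proof.
split.
- move=> N; apply: continuous_mul; apply: continuous_scale; apply: continuous_rescaled.
    exact: continuous_hat.
  exact: continuous_layer.
- exists 2 => N s s0; set M := (k N).+1%:R : R.
  have M0 : 0 < M by rewrite /M.
  have Ms : 0 <= M * s by rewrite mulr_ge0// ltW.
  have /andP[l0 _] := layer_itv Ms; have l1 := layer_le Ms.
  have /andP[h0 _] := hat_itv (N.+1%:R * s).
  have /andP[_ h2] := hat_mul_le (N.+1%:R * s).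
  have A0 : 0 <= N.+1%:R * hat (N.+1%:R * s) :> R by rewrite mulr_ge0.
  rewrite ger0_norm ?mulr_ge0//; last by rewrite invr_ge0 ltW.
  apply: le_trans h2; rewrite [hat _ * _]mulrCA mulrA ler_wpM2l//.
  by rewrite ler_pdivrMl.
- move=> s s0; apply: (@cvg_trans _ ((fun=> 0 : R) @ \oo)); last exact: cvg_cst.
  apply: near_eq_cvg; near=> N; rewrite hat_ge2 ?mulr0 ?mul0r//.
  by near: N; exact: near_rescaled_ge2.
Unshelve. all: by end_near. Qed.

End layers.

Section boundary_layers.
Context {R : realType} {n : nat} (Om K : set 'rV[R]_n) (a : 'rV[R]_n -> 'M[R]_n).
Variables (e : 'I_n) (sg : R) (rho chi : 'rV[R]_n -> R).
Hypotheses (oO : open Om) (bO : bounded_set Om).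
Hypothesis Ca : forall i j, C1_closure Om (fun x => a x i j).
Hypothesis Col : collar Om K e sg rho chi.
Local Notation leb := (lebesgue_rV n).

Let Crho := collar_rho Col.
Let Cchi := collar_chi Col.

Definition blayer N (x : 'rV[R]_n) : R :=
  N.+1%:R^-1 * (chi x * layer (N.+1%:R * rho x)).

Let rescaled N x := N.+1%:R * rho x.

Let Ck_rescaled N : Ck 2 setT (rescaled N).
Proof. exact: (CkM (@Ck_cst R n 2 N.+1%:R) Crho). Qed.

Let pd_rescaled N i x :
  is_derive x (delta_mx ord0 i : 'rV[R]_n) (rescaled N) (N.+1%:R * pd i rho x).
Proof. exact: (is_deriveZ N.+1%:R (Ck_is_derive i x Crho)). Qed.

Let pd_layer N i x : is_derive x (delta_mx ord0 i : 'rV[R]_n)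
  (fun y => layer (rescaled N y))
  ((1 - ramp (rescaled N x)) * (N.+1%:R * pd i rho x)).
Proof. exact: is_derive_comp (is_derive_layer _) (pd_rescaled N i x). Qed.

Let pd_cramp N i x : is_derive x (delta_mx ord0 i : 'rV[R]_n)
  (fun y => 1 - ramp (rescaled N y))
  (- hat (rescaled N x) * (N.+1%:R * pd i rho x)).
Proof. exact: is_derive_comp (is_derive_opp_ramp _) (pd_rescaled N i x). Qed.

Lemma Ck_blayer N : Ck 2 setT (blayer N).
Proof.
apply: (CkM (@Ck_cst R n 2 N.+1%:R^-1)); apply: (CkM Cchi).
apply: (Ck2_comp is_derive_layer is_derive_opp_ramp _ (Ck_rescaled N)).
by move=> s; apply: continuousN; exact: continuous_hat.
Qed.

Lemma pd_blayer N j : pd j (blayer N) = fun x =>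
  N.+1%:R^-1 * layer (rescaled N x) * pd j chi x +
  (1 - ramp (rescaled N x)) * (chi x * pd j rho x).
Proof.
apply/funext => x.
have [_] := is_deriveZ N.+1%:R^-1
  (is_derive_mul (Ck_is_derive j x Cchi) (pd_layer N j x)).
rewrite /pd => ->; rewrite /GRing.scale /= -/(pd j rho x) -/(pd j chi x).
have := @pnatr_eq0 R N.+1; move: (N.+1%:R) => k k0.
by field; rewrite k0.
Qed.

Lemma pd_pd_blayer N i j x : pd i (pd j (blayer N)) x =
  N.+1%:R^-1 * layer (rescaled N x) * pd i (pd j chi) x +
  (1 - ramp (rescaled N x)) * (pd j chi x * pd i rho x +
     (pd i chi x * pd j rho x + chi x * pd i (pd j rho) x)) -
  N.+1%:R * hat (rescaled N x) * (chi x * (pd i rho x * pd j rho x)).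
Proof.
rewrite pd_blayer.
have h1 := is_derive_mul (is_deriveZ N.+1%:R^-1 (pd_layer N i x))
  (Ck_is_derive i x (Ck_pd j Cchi)).
have h2 := is_derive_mul (pd_cramp N i x) (is_derive_mul
  (Ck_is_derive i x (Ck_le Cchi)) (Ck_is_derive i x (Ck_pd j Crho))).
have [_ h] := is_deriveD h1 h2.
apply: (etrans h); rewrite /= /GRing.scale /=.
have := @pnatr_eq0 R N.+1; move: (N.+1%:R) => k k0.
by field; rewrite k0.
Qed.

(** The coefficient of the concentrating term. *)
Let conormal x := chi x * \sum_i \sum_j a x i j * (pd i rho x * pd j rho x).

(** The part of the divergence without a second derivative of the profile. *)
Let remainder N x := \sum_i \sum_j
  (pd i (fun y => a y i j) x * pd j (blayer N) x + a x i j *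
   (N.+1%:R^-1 * layer (rescaled N x) * pd i (pd j chi) x +
    (1 - ramp (rescaled N x)) * (pd j chi x * pd i rho x +
     (pd i chi x * pd j rho x + chi x * pd i (pd j rho) x)))).

(** Only the term where both derivatives fall on the profile has a factor N. *)
Lemma div_grad_blayer N x : Om x -> div_grad a (blayer N) x =
  remainder N x - N.+1%:R * hat (rescaled N x) * conormal x.
Proof.
move=> Ox; rewrite (div_gradE Ca (Ck_blayer N) Ox).
rewrite /conormal mulrA mulr_sumr -sumrB; apply: eq_bigr => i _.
rewrite mulr_sumr -sumrB; apply: eq_bigr => j _.
rewrite pd_pd_blayer [X in _ + X = _]mulrBr addrA; congr (_ - _).
by rewrite mulrCA [a x i j * (chi x * _)]mulrCA -!mulrA.
Qed.

Let chiK x : ~ K x -> chi x = 0. Proof. exact: (collar_chi0 Col). Qed.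

Let oK : open (~` K).
Proof.
apply: closed_openC; apply: compact_closed; first exact: norm_hausdorff.
exact: (collar_compact Col).
Qed.

Let pd_chiK i x : ~ K x -> pd i chi x = 0.
Proof. exact: (pd_support i oK chiK). Qed.

Let pd_pd_chiK i j x : ~ K x -> pd i (pd j chi) x = 0.
Proof. exact: (pd_support i oK (@pd_chiK j)). Qed.

Let bddC k f : Ck k setT f -> bdd Om f.
Proof. exact: Ck_bdd. Qed.

Let remainder_negl : negl Om remainder.
Proof.
have nL (A : 'rV[R]_n -> R) : bdd Om A -> (forall x, ~ K x -> A x = 0) ->
    negl Om (fun N x => N.+1%:R^-1 * layer (rescaled N x) * A x).
  move=> bA A0; apply: negl_eq (profile_negl oO Col bA A0 profile_layer) => N x _.
  by rewrite mulrC.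
have nR (A : 'rV[R]_n -> R) : bdd Om A -> (forall x, ~ K x -> A x = 0) ->
    negl Om (fun N x => (1 - ramp (rescaled N x)) * A x).
  move=> bA A0; apply: negl_eq (profile_negl oO Col bA A0 profile_ramp) => N x _.
  by rewrite mulrC.
apply: negl_sum => i; apply: negl_sum => j; apply: neglD; apply: neglMl.
- exact: pd_coef_bdd.
- rewrite (_ : (fun N => pd j (blayer N)) = (fun N x =>
    N.+1%:R^-1 * layer (rescaled N x) * pd j chi x +
    (1 - ramp (rescaled N x)) * (chi x * pd j rho x))); last first.
    by apply/funext => N; rewrite pd_blayer.
  apply: neglD.
    apply: nL => [|x /pd_chiK//]; exact: (bddC (Ck_pd j Cchi)).
  apply: nR => [|x /chiK->]; last by rewrite mul0r.
  by apply: bddM; [exact: (bddC Cchi)|exact: (bddC (Ck_pd j Crho))].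
- exact: coef_bdd.
- apply: neglD.
    apply: nL => [|x /pd_pd_chiK//]; exact: (bddC (Ck_pd i (Ck_pd j Cchi))).
  apply: nR => [|x nKx]; last first.
    by rewrite !pd_chiK// chiK// !mul0r !addr0.
  apply: bddD.
    by apply: bddM; [exact: (bddC (Ck_pd j Cchi))|exact: (bddC (Ck_pd i Crho))].
  apply: bddD.
    by apply: bddM; [exact: (bddC (Ck_pd i Cchi))|exact: (bddC (Ck_pd j Crho))].
  by apply: bddM; [exact: (bddC Cchi)|exact: (bddC (Ck_pd i (Ck_pd j Crho)))].
Qed.

Let conormal_bdd : bdd Om conormal.
Proof.
apply: bddM; first exact: (bddC Cchi).
apply: bdd_sum => i; apply: bdd_sum => j; apply: bddM; first exact: coef_bdd.
by apply: bddM; [exact: (bddC (Ck_pd i Crho))|exact: (bddC (Ck_pd j Crho))].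
Qed.

Lemma blayer_negl : negl Om blayer.
Proof.
apply: negl_eq (profile_negl oO Col (bddC Cchi) chiK profile_layer) => N x _.
by rewrite /blayer mulrCA.
Qed.

Lemma div_grad_blayer_mul_negl (k : nat -> nat) :
  negl Om (fun N x => div_grad a (blayer N) x * blayer (k N) x).
Proof.
have [mB bB _] := blayer_negl.
have n1 : negl Om (fun N x => remainder N x * blayer (k N) x).
  apply: neglM remainder_negl _ _ => [N|]; first exact: mB.
  by have [M hM] := bB; exists M => N x; exact: hM.
have n2 : negl Om (fun N x => -1 * (conormal x * chi x * (N.+1%:R *
    hat (N.+1%:R * rho x) * ((k N).+1%:R^-1 * layer ((k N).+1%:R * rho x))))).
  apply: neglMl; first exact: bdd_cst.
  apply: (profile_negl oO Col _ _ (profile_hat_layer k)) => [|x /chiK->].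
    by apply: bddM => //; exact: (bddC Cchi).
  by rewrite mulr0.
apply: negl_eq (neglD n1 n2) => N x Ox; rewrite div_grad_blayer// mulrBl mulN1r.
congr (_ - _); rewrite /blayer /rescaled.
move: (layer _) (hat _) => l h; move: (conormal x) (chi x) => s c.
by ring.
Qed.

Lemma div_grad_blayer_bdd N : bdd Om (div_grad a (blayer N)).
Proof. exact: (div_grad_bdd oO bO Ca (Ck_blayer N)). Qed.

(** The partial derivative along e of chi ramp(N rho) has integral 0, and the
    derivative of rho along e is the constant sg. This turns the integral into
    that of - sg (d_e chi) ramp(N rho), which is nonnegative, and bounded below
    on a ball on which ramp(N rho) = 1 for N large. *)
Lemma flux_lower_bound : exists2 F0 : R, 0 < F0 & \forall N \near \oo,
  F0 <= \int[leb]_x (chi x * (N.+1%:R * hat (rescaled N x))).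
Proof.
have sg2 := collar_sg Col.
have [x1 [r1 [h [c1 [r10 h0 c10 hin]]]]] := collar_inner Col.
pose B := ball x1 r1.
have mB : measurable B by apply: open_measurable_rV; exact: ball_open.
have [M hM] := bounded_norm_le (compact_bounded (collar_compact Col)).
have MK x : M < `|x| -> ~ K x by move=> Mx /hM; rewrite leNgt Mx.
pose g N x := ramp (rescaled N x) * chi x.
have Cg N : Ck 1 setT (g N).
  apply: CkM; last exact: Ck_le.
  exact: (Ck1_comp is_derive_ramp continuous_hat (Ck_le (Ck_rescaled N))).
have dg N x : pd e (g N) x =
    hat (rescaled N x) * (N.+1%:R * sg) * chi x + ramp (rescaled N x) * pd e chi x.
  have [_] := is_derive_mul (is_derive_comp (is_derive_ramp _) (pd_rescaled N e x))
    (Ck_is_derive e x Cchi).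
  by rewrite (collar_pd_rho Col).
have c_hat N : continuous (fun x => hat (rescaled N x)).
  move=> x; apply: continuous_comp; first exact: (Ck_continuous (Ck_rescaled N)).
  exact: continuous_hat.
pose p N x := chi x * (N.+1%:R * hat (rescaled N x)).
pose q N x := ramp (rescaled N x) * (- sg * pd e chi x).
have dgE N x : - sg * pd e (g N) x = q N x - p N x.
  rewrite dg /q /p; move: (N.+1%:R) => k.
  rewrite mulrDr (_ : - sg * (_ * _ * chi x) =
    - (sg * sg) * (chi x * (k * hat (rescaled N x)))); last by ring.
  by rewrite sg2; ring.
have ip N : leb.-integrable setT (EFin \o p N).
  apply: (@continuous_support_integrable _ _ _ M).
    move=> x; apply: (@continuousM _ _ chi (fun x => N.+1%:R * hat (rescaled N x))).
      exact: (Ck_continuous Cchi).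
    apply: (@continuousM _ _ (cst (N.+1%:R : R))); first exact: cst_continuous.
    exact: c_hat.
  by move=> x /MK/chiK; rewrite /p => ->; rewrite mul0r.
have iq N : leb.-integrable setT (EFin \o q N).
  apply: (@continuous_support_integrable _ _ _ M).
    move=> x; apply: (@continuousM _ _ (fun x => ramp (rescaled N x))).
      apply: continuous_comp; first exact: (Ck_continuous (Ck_rescaled N)).
      exact: continuous_ramp.
    apply: (@continuousM _ _ (cst (- sg))); first exact: cst_continuous.
    exact: (Ck_continuous (Ck_pd e Cchi)).
  by move=> x /MK/(pd_chiK e); rewrite /q => ->; rewrite !mulr0.
have pq N : \int[leb]_x p N x = \int[leb]_x q N x.
  have ig : leb.-integrable setT (EFin \o pd e (g N)).
    apply: (@continuous_support_integrable _ _ _ M).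
      exact: (Ck_continuous (Ck_pd e (Cg N))).
    by move=> x /MK Kx; rewrite dg chiK// pd_chiK// !mulr0 addr0.
  have : \int[leb]_x pd e (g N) x = 0.
    rewrite /Rintegral (@integral_pd_eq0 _ _ _ e M)//.
    - exact: (Ck_continuous (Cg N)).
    - by move=> x; case: (Ck_is_derive e x (Cg N)).
    - exact: (Ck_continuous (Ck_pd e (Cg N))).
    - by move=> x /MK Kx; rewrite /g chiK// mulr0.
  move=> /(congr1 (fun z => - sg * z)); rewrite mulr0 -RintegralZl//.
  under eq_Rintegral do rewrite dgE.
  by rewrite RintegralB// => /subr0_eq.
have q0 N x : 0 <= q N x.
  have /andP[ra0 _] := ramp_itv (rescaled N x).
  have [r0|r0] := leP (rho x) 0.
    rewrite /q ramp_le0 ?mul0r//.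
    by rewrite mulr_ge0_le0.
  by apply: mulr_ge0 => //; exact: (collar_pd_chi Col).
have Boo : (leb B < +oo)%E by rewrite lebesgue_rV_ball// ltry.
exists (c1 * fine (leb B)).
  by rewrite mulr_gt0// lebesgue_rV_ball//= exprn_gt0// mulrn_wgt0.
near=> N; rewrite [leRHS]pq -Rintegral_cst// Rintegral_mkcond.
apply: le_Rintegral => //.
  rewrite -restrict_EFin; apply/(integrable_mkcond _ mB).1.
  apply: measurable_bounded_integrable => //.
  by exists c1; split; [rewrite num_real|move=> L cL x _ /=; rewrite gtr0_norm// ltW].
move=> x _; rewrite patchE; case: ifPn => [|_]; last exact: q0.
rewrite inE => /hin[hx cx]; rewrite /q ramp_ge2 ?mul1r//.
have : 2 <= N.+1%:R * h by near: N; exact: near_rescaled_ge2.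
by move=> /le_trans; apply; rewrite /rescaled ler_wpM2l.
Unshelve. all: by end_near. Qed.

Lemma blayer_bdry N x : bdry Om x -> blayer N x = 0.
Proof.
move=> bx; have [Kx|nKx] := pselect (K x); last by rewrite /blayer chiK// mul0r mulr0.
by rewrite /blayer (collar_bdry Col Kx bx) mulr0 layer0 !mulr0.
Qed.

Variable c : R.
Hypothesis c0 : 0 < c.
Hypothesis ell : forall x xi : 'rV[R]_n, Om x ->
  c * enorm xi ^+ 2 <= (xi *m a x *m xi^T) ord0 ord0.

Let mOm : measurable Om. Proof. exact: open_measurable_rV. Qed.
Let Omoo : (leb Om < +oo)%E. Proof. exact: open_bounded_lt_oo. Qed.

Let conormal_ge x : Om x -> c * chi x <= conormal x.
Proof.
move=> Ox; pose xi : 'rV[R]_n := \row_i pd i rho x.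
have -> : conormal x = chi x * (xi *m a x *m xi^T) ord0 ord0.
  congr (_ * _); rewrite mxE exchange_big; apply: eq_bigr => j _.
  rewrite !mxE mulr_suml; apply: eq_bigr => i _.
  by rewrite !mxE mulrCA mulrA.
rewrite mulrC ler_wpM2l ?(collar_chi_ge0 Col)//.
apply: le_trans (ell xi Ox); rewrite ler_peMr ?(ltW c0)//.
rewrite /enorm sqr_sqrtr; last by apply: sumr_ge0 => i _; exact: sqr_ge0.
rewrite (bigD1 e)//= !mxE (collar_pd_rho Col) expr2 (collar_sg Col) lerDl.
by apply: sumr_ge0 => i _; exact: sqr_ge0.
Qed.

(** Since the derivative of rho along e is sg with sg^2 = 1, ellipticity gives
    a grad rho . grad rho >= c. *)
Lemma blayer_flux : exists2 F0 : R, 0 < F0 & \forall N \near \oo,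
  F0 <= \int[leb]_(x in Om) (- div_grad a (blayer N) x).
Proof.
have [F0 F00 hF] := flux_lower_bound.
exists (c * F0 / 2); first by rewrite divr_gt0// mulr_gt0.
have nr : negl Om (fun N x => -1 * remainder N x).
  by apply: neglMl => //; exact: bdd_cst.
have cr := negl_cvg mOm Omoo nr.
have e0 : 0 < c * F0 / 2 by rewrite divr_gt0// mulr_gt0.
near=> N.
have b1 : bdd Om (fun x => c * (chi x * (N.+1%:R * hat (rescaled N x)))).
  apply: bddZ; apply: bddM; first exact: (bddC Cchi).
  apply: bddZ; split; last first.
    by exists 1 => x _; have /andP[? ?] := hat_itv (rescaled N x); rewrite ger0_norm.
  apply: continuous_measurable_rV => // x _.
  apply: continuous_comp; [exact: (Ck_continuous (Ck_rescaled N))|exact: continuous_hat].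
have b2 := negl_bdd N nr.
apply: (@le_trans _ _ (\int[leb]_(x in Om)
    (c * (chi x * (N.+1%:R * hat (rescaled N x))) + -1 * remainder N x))).
  rewrite (bdd_RintegralD mOm Omoo b1 b2).
  have b1' : bdd Om (fun x => chi x * (N.+1%:R * hat (rescaled N x))).
    apply: bdd_eq (bddZ c^-1 b1) => x _.
    by rewrite mulrA mulVf ?mul1r// gt_eqF.
  rewrite (bdd_RintegralZ mOm Omoo c b1') Rintegral_support; last first.
    move=> x nOx; have [Kx|/chiK->] := pselect (K x); last by rewrite mul0r.
    rewrite hat_le0 ?mulr0// /rescaled mulr_ge0_le0// leNgt; apply/negP => r0.
    by apply: nOx; apply/(collar_domain Col Kx).
  have h1 : c * F0 <= c * \int[leb]_x (chi x * (N.+1%:R * hat (rescaled N x))).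
    by rewrite ler_pM2l//; near: N.
  have : `|\int[leb]_(x in Om) (-1 * remainder N x)| <= c * F0 / 2.
    near: N; exact: near_norm_le cr e0.
  rewrite ler_norml => /andP[h2 _]; lra.
apply: bdd_le_Rintegral => //.
- exact: bddD.
- apply: bdd_eq (bddZ (-1) (div_grad_blayer_bdd N)) => x _; exact: mulN1r.
move=> x Ox; rewrite div_grad_blayer// opprB mulN1r lerD2r.
have h : 0 <= N.+1%:R * hat (rescaled N x) :> R.
  by rewrite mulr_ge0//; have /andP[] := hat_itv (rescaled N x).
rewrite [leLHS](_ : _ = N.+1%:R * hat (rescaled N x) * (c * chi x)); last by ring.
exact: ler_wpM2l h _ _ (conormal_ge Ox).
Unshelve. all: by end_near. Qed.

(** The layer of scale N is corrected by a multiple of a fixed layer of nonzero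
    mean; the coefficient tends to 0 because the means do. If all the means
    vanish the coefficient is 0, by the convention x / 0 = 0. *)
Lemma mean_zero_layer (mu : probability 'rV[R]_n R) :
  exists2 F0 : R, 0 < F0 & forall eps : R, 0 < eps -> exists w : 'rV[R]_n -> R,
    [/\ Ck 2 setT w, forall x, bdry Om x -> w x = 0 &
     [/\ \int[mu]_(x in Om) w x = 0,
        F0 <= \int[leb]_(x in Om) (- div_grad a w x),
        `|\int[leb]_(x in Om) (- div_grad a w x * w x)| <= eps,
        `|\int[leb]_(x in Om) w x| <= eps &
        `|\int[leb]_(x in Om) (w x ^+ 2)| <= eps]].
Proof.
have [F0 F00 hF] := blayer_flux.
exists (F0 / 2); first by rewrite divr_gt0.
move=> eps eps0.
have muOm : (mu Om < +oo)%E.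
  by apply: (le_lt_trans (probability_le1 mu mOm)); rewrite ltry.
pose mean N := \int[mu]_(x in Om) blayer N x.
have mean0 : mean N @[N --> \oo] --> (0 : R) := negl_cvg mOm muOm blayer_negl.
have [k hk] : exists k, mean k != 0 \/ forall N, mean N = 0.
  have [[k hk]|h] := pselect (exists k, mean k != 0); first by exists k; left.
  exists 0%N; right => N; apply: contrapT => /eqP hN; apply: h; by exists N.
pose co N := - (mean N / mean k).
have mean_co N : mean N + co N * mean k = 0.
  case: hk => [k0|z]; last by rewrite !z mulr0 addr0.
  by rewrite /co mulNr divfK// subrr.
have co0 : co N @[N --> \oo] --> (0 : R).
  rewrite -[X in _ --> X]oppr0 -(mul0r (mean k)^-1).
  by apply: cvgN; apply: cvgM => //; exact: cvg_cst.
pose w N x := blayer N x + co N * blayer k x.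
have Cw N : Ck 2 setT (w N).
  exact: (CkD (Ck_blayer N) (CkM (@Ck_cst R n 2 (co N)) (Ck_blayer k))).
pose L N := div_grad a (blayer N).
have bL N : bdd Om (L N) := div_grad_blayer_bdd N.
have bb N : bdd Om (blayer N) := negl_bdd N blayer_negl.
have LwE N x : Om x -> div_grad a (w N) x = L N x + co N * L k x.
  exact: (div_gradDZ Ca (co N) (Ck_blayer N) (Ck_blayer k)).
pose I f := \int[leb]_(x in Om) f x.
have ID f g : bdd Om f -> bdd Om g -> I (fun x => f x + g x) = I f + I g.
  by move=> bf bg; exact: (bdd_RintegralD mOm Omoo bf bg).
have IZ r f : bdd Om f -> I (fun x => r * f x) = r * I f.
  by move=> bf; exact: (bdd_RintegralZ mOm Omoo r bf).
have eqI f g : (forall x, Om x -> f x = g x) -> I f = I g.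
  by move=> fg; apply: eq_Rintegral => x /set_mem; exact: fg.
have c1 : I (fun x => L N x * blayer N x) @[N --> \oo] --> (0 : R).
  exact: (negl_cvg mOm Omoo (div_grad_blayer_mul_negl id)).
have c2 : I (fun x => L N x * blayer k x) @[N --> \oo] --> (0 : R).
  exact: (negl_cvg mOm Omoo (div_grad_blayer_mul_negl (fun=> k))).
have c3 : I (fun x => L k x * blayer N x) @[N --> \oo] --> (0 : R).
  exact: (negl_cvg mOm Omoo (neglMl (bL k) blayer_negl)).
have c4 : I (blayer N) @[N --> \oo] --> (0 : R).
  exact: (negl_cvg mOm Omoo blayer_negl).
have c5 : I (fun x => blayer N x * blayer N x) @[N --> \oo] --> (0 : R).
  have [mB bB _] := blayer_negl.
  exact: (negl_cvg mOm Omoo (neglM blayer_negl mB bB)).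
have c6 : I (fun x => blayer k x * blayer N x) @[N --> \oo] --> (0 : R).
  exact: (negl_cvg mOm Omoo (neglMl (bb k) blayer_negl)).
have quad f g f' g' r : bdd Om f -> bdd Om g -> bdd Om f' -> bdd Om g' ->
    I (fun x => (f x + r * g x) * (f' x + r * g' x)) =
    I (fun x => f x * f' x) + r * (I (fun x => f x * g' x) + I (fun x => g x * f' x))
    + r ^+ 2 * I (fun x => g x * g' x).
  move=> bf bg bf' bg'.
  rewrite -ID; [|exact: bddM..]. rewrite -IZ; last by apply: bddD; exact: bddM.
  rewrite -ID; [|exact: bddM|by apply: bddZ; apply: bddD; exact: bddM].
  rewrite -IZ; last exact: bddM.
  rewrite -ID; [|by apply: bddD; [exact: bddM|apply: bddZ; apply: bddD; exact: bddM]
    |by apply: bddZ; exact: bddM].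
  by apply: eqI => x _; ring.
have quad0 (u1 u2 u3 : nat -> R) z : u1 N @[N --> \oo] --> (0 : R) ->
    u2 N @[N --> \oo] --> (0 : R) -> u3 N @[N --> \oo] --> (0 : R) ->
    u1 N + co N * (u2 N + u3 N) + co N ^+ 2 * z @[N --> \oo] --> (0 : R).
  move=> h1 h2 h3.
  rewrite -[X in _ --> X](_ : 0 + 0 * (0 + 0) + 0 * 0 * z = 0); last first.
    by rewrite !mul0r !addr0.
  apply: cvgD; last by apply: cvgM; [exact: (cvgM co0 co0)|exact: cvg_cst].
  by apply: cvgD => //; apply: cvgM => //; exact: cvgD.
have cA := quad0 _ _ _ (I (fun x => L k x * blayer k x)) c1 c2 c3.
have cB := quad0 _ _ _ (I (fun x => blayer k x * blayer k x)) c5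
  (c6 : I (fun x => blayer k x * blayer N x) @[N --> \oo] --> (0 : R)) c6.
have cm : I (blayer N) + co N * I (blayer k) @[N --> \oo] --> (0 : R).
  rewrite -[X in _ --> X]addr0 -[X in _ + X](mul0r (I (blayer k))).
  by apply: cvgD => //; apply: cvgM => //; exact: cvg_cst.
have cF : co N * I (L k) @[N --> \oo] --> (0 : R).
  by rewrite -[X in _ --> X](mul0r (I (L k))); apply: cvgM => //; exact: cvg_cst.
have F20 : 0 < F0 / 2 by rewrite divr_gt0.
have near5 : \forall N \near \oo, [/\ F0 <= I (fun x => - L N x),
   `|co N * I (L k)| <= F0 / 2,
   `|I (fun x => L N x * blayer N x) + co N *
       (I (fun x => L N x * blayer k x) + I (fun x => L k x * blayer N x)) +
     co N ^+ 2 * I (fun x => L k x * blayer k x)| <= eps,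
   `|I (fun x => blayer N x * blayer N x) + co N *
       (I (fun x => blayer k x * blayer N x) + I (fun x => blayer k x * blayer N x)) +
     co N ^+ 2 * I (fun x => blayer k x * blayer k x)| <= eps
   & `|I (blayer N) + co N * I (blayer k)| <= eps].
  near=> N; split; near: N.
  - exact: hF.
  - exact: (near_norm_le cF F20).
  - exact: (near_norm_le cA eps0).
  - exact: (near_norm_le cB eps0).
  - exact: (near_norm_le cm eps0).
have [N _ hN] := near5; have [h1 h2 h3 h4 h5] := hN N (leqnn N).
exists (w N); split; first exact: Cw.
  by move=> x bx; rewrite /w !blayer_bdry// mulr0 addr0.
split.
- rewrite -(mean_co N) /mean -bdd_RintegralZ//.
  by rewrite -bdd_RintegralD//; exact: bddZ.
- rewrite -/(I _) (_ : I _ = I (fun x => - L N x) - co N * I (L k)).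
    by move: h2; rewrite ler_norml => /andP[_]; lra.
  rewrite -IZ// -mulN1r -IZ; last exact: bddZ.
  rewrite -ID; last 2 first.
    by apply: bdd_eq (bddZ (-1) (bL N)) => x _; exact: mulN1r.
    by do 2 apply: bddZ.
  by apply: eqI => x Ox; rewrite LwE// opprD mulN1r.
- rewrite -/(I _) (_ : I _ = -1 * I (fun x => (L N x + co N * L k x) * w N x)).
    by rewrite mulN1r normrN /w quad.
  rewrite -IZ; first by apply: eqI => x Ox; rewrite LwE// mulN1r mulNr.
  by apply: bddM; apply: bddD => //; exact: bddZ.
- by rewrite -/(I _) /w (ID _ _ (bb N) (bddZ (co N) (bb k))) (IZ _ _ (bb k)).
- rewrite -/(I _) (_ : I _ = I (fun x => w N x * w N x)); last first.
    by apply: eqI => x _; rewrite expr2.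
  rewrite /w quad//.
  rewrite (eqI (fun x => blayer N x * blayer k x)
    (fun x => blayer k x * blayer N x))// => x _.
  by rewrite mulrC.
Unshelve. all: by end_near. Qed.

End boundary_layers.

(** * The equation for the coefficient of the layer *)

(** With s = x^2 + y^2 prescribed, the second and third equations give x and y in
    terms of N, and the first one becomes linear in N, whose solution is
    al + be s. It remains to solve s = x(s)^2 + y(s)^2: the right-hand side is
    nonnegative at 0, and at most s0 at s = s0, where s0 bounds it whenever
    0 < N <= 2 V and |s A| <= 1. *)
Lemma numerical_range_equation (R : realType) (V F0 p q : R) : 0 < V -> 0 < F0 ->
  exists2 eps : R, 0 < eps & forall F A m B : R, F0 <= F ->
    `|A| <= eps -> `|m| <= eps -> `|B| <= eps ->
    exists x y N : R, [/\ 0 < N, N = V + 2 * x * m + (x ^+ 2 + y ^+ 2) * B,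
      x * F + (x ^+ 2 + y ^+ 2) * A = p * N & y * F = q * N].
Proof.
move=> V0 F00.
pose s0 := ((2 * `|p| * V + 1) ^+ 2 + (2 * `|q| * V) ^+ 2) / F0 ^+ 2.
have s00 : 0 <= s0 by rewrite divr_ge0// ?addr_ge0// sqr_ge0.
have s10 : 0 < s0 + 1 by rewrite ltr_wpDl.
have p1 : 0 < `|p| + 1 by rewrite ltr_wpDl.
(* In this order the bounds give |A| <= 1, |u| <= 1 / 4, |s B| <= V / 8, |s A| <= 1
   and |2 m s A / F| <= V / 8 for 0 <= s <= s0. *)
pose eps := Num.min 1 (Num.min (F0 / (8 * (`|p| + 1))) (Num.min (V / (8 * (s0 + 1)))
  (Num.min (1 / (s0 + 1)) (V * F0 / (16 * (s0 + 1)))))).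
exists eps; first by rewrite /eps !lt_min ltr01 !divr_gt0// ?mulr_gt0//.
move=> F A m B FF0 hA hm hB.
have F_gt0 : 0 < F by exact: lt_le_trans FF0.
have Fn0 : F != 0 by rewrite gt_eqF.
have : eps <= eps by [].
rewrite {2}/eps !le_min => /andP[e1 /andP[e2 /andP[e3 /andP[e4 e5]]]].
have eps0 : 0 <= eps by apply: le_trans hA.
have eF : eps * (8 * (`|p| + 1)) <= F0 by rewrite -ler_pdivlMr// mulr_gt0.
have eV : eps * (8 * (s0 + 1)) <= V by rewrite -ler_pdivlMr// mulr_gt0.
have es : eps * (s0 + 1) <= 1 by rewrite -ler_pdivlMr.
have eVF : eps * (16 * (s0 + 1)) <= V * F0 by rewrite -ler_pdivlMr// mulr_gt0.
pose u := 2 * m * p / F.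
have hu : `|u| <= 1 / 4.
  rewrite /u normf_div (gtr0_norm F_gt0) ler_pdivrMr// !normrM ger0_norm//.
  have : `|m| * `|p| <= eps * `|p| by rewrite ler_wpM2r.
  by lra.
have [al alE] : exists al, al = V / (1 - u) by eexists.
have [be beE] : exists be, be = (B - 2 * m * A / F) / (1 - u) by eexists.
have u1 : 0 < 1 - u by move: hu; rewrite ler_norml => /andP[]; lra.
have hN s : 0 <= s <= s0 -> 0 < al + be * s <= 2 * V.
  move=> /andP[sge0 sles0].
  have hsB : `|s * B| <= V / 8.
    rewrite normrM ger0_norm//; apply: (@le_trans _ _ (s0 * eps)); last by lra.
    by apply: ler_pM.
  have hsA : `|2 * m * s * A / F| <= V / 8.
    rewrite normf_div (gtr0_norm F_gt0) ler_pdivrMr// !normrM ger0_norm//.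
    rewrite (ger0_norm sge0).
    apply: (@le_trans _ _ (2 * eps * s0 * 1)).
      by do !apply: ler_pM => //; rewrite ?mulr_ge0//; exact: le_trans e1.
    have : V * F0 <= V * F by rewrite ler_pM2l.
    by lra.
  have -> : al + be * s = (V + (s * B - 2 * m * s * A / F)) / (1 - u).
    by rewrite alE beE; field; rewrite Fn0 gt_eqF.
  set w := _ - _.
  have hw : `|w| <= V / 4.
    by apply: (le_trans (ler_normB _ _)); lra.
  move: hw hu; rewrite !ler_norml => /andP[w1 w2] /andP[v1 v2].
  rewrite divr_gt0//=; last by lra.
  rewrite ler_pdivrMr//; nra.
pose P : {poly R} := 'X - (((p * al) / F)%:P + ((p * be - A) / F) *: 'X) ^+ 2
  - (((q * al) / F)%:P + ((q * be) / F) *: 'X) ^+ 2.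
pose x s := (p * (al + be * s) - s * A) / F.
pose y s := q * (al + be * s) / F.
have PE s : P.[s] = s - x s ^+ 2 - y s ^+ 2.
  by rewrite /P !(hornerD, hornerN, horner_exp, hornerX, hornerC, hornerZ) /x /y; field.
have [t ht /rootP] : exists2 s, 0 <= s <= s0 & root P s.
  apply: (@poly_ivt _ P 0 s0 s00); rewrite !PE sub0r.
  apply/andP; split.
    by have := sqr_ge0 (x 0); have := sqr_ge0 (y 0); lra.
  have /andP[N1 N2] := hN s0 (introT andP (conj s00 (lexx _))).
  set N := al + be * s0 in N1 N2 *.
  have aN : `|N| <= 2 * V by rewrite gtr0_norm.
  have hx : x s0 ^+ 2 <= (2 * `|p| * V + 1) ^+ 2 / F0 ^+ 2.
    rewrite -expr_div_n -[leLHS]real_normK ?num_real// lerXn2r ?nnegrE//.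
      by rewrite divr_ge0 ?ltW// ltr_wpDl// mulr_ge0// ?mulr_ge0// ltW.
    rewrite /x -/N normf_div (gtr0_norm F_gt0).
    apply: ler_pM => //; first by rewrite invr_ge0 ltW.
      apply: (le_trans (ler_normB _ _)).
      rewrite [`|p * N|]normrM [`|s0 * A|]normrM (ger0_norm s00).
      apply: lerD.
        by rewrite (_ : 2 * `|p| * V = `|p| * (2 * V)) ?ler_wpM2l//; ring.
      by apply: (@le_trans _ _ (s0 * eps)); [rewrite ler_wpM2l|lra].
    by rewrite lef_pV2// posrE.
  have hy : y s0 ^+ 2 <= (2 * `|q| * V) ^+ 2 / F0 ^+ 2.
    rewrite -expr_div_n -[leLHS]real_normK ?num_real// lerXn2r ?nnegrE//.
      by apply: divr_ge0; [rewrite !mulr_ge0// ltW|exact: ltW].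
    rewrite /y -/N normf_div (gtr0_norm F_gt0).
    apply: ler_pM => //; first by rewrite invr_ge0 ltW.
      by rewrite normrM (_ : 2 * `|q| * V = `|q| * (2 * V)) ?ler_wpM2l//; ring.
    by rewrite lef_pV2// posrE.
  have : s0 = (2 * `|p| * V + 1) ^+ 2 / F0 ^+ 2 + (2 * `|q| * V) ^+ 2 / F0 ^+ 2.
    by rewrite -mulrDl.
  lra.
rewrite PE => E.
have Es : x t ^+ 2 + y t ^+ 2 = t by move: E; lra.
exists (x t), (y t), (al + be * t); rewrite Es; split.
- by have /andP[] := hN t ht.
- rewrite /x alE beE /u; field.
  rewrite Fn0 /= gt_eqF//.
  have : 0 < F * (1 - u) by rewrite mulr_gt0.
  by rewrite /u (_ : F * _ = F - 2 * m * p)//; field.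
- by rewrite /x; field.
- by rewrite /y; field.
Qed.

(** * States in the domain and the numerical range *)

Section test_state.
Context {R : realType} {n : nat} (Om : set 'rV[R]_n) (a : 'rV[R]_n -> 'M[R]_n).
Hypotheses (oO : open Om) (bO : bounded_set Om).
Hypothesis Ca : forall i j, C1_closure Om (fun x => a x i j).
Local Notation leb := (@lebesgue_rV R n).
Variables (k : R) (t : R[i]) (w : 'rV[R]_n -> R).
Hypothesis Cw : Ck 2 setT w.

Let mOm : measurable Om. Proof. exact: open_measurable_rV. Qed.
Let Omoo : (leb Om < +oo)%E. Proof. exact: open_bounded_lt_oo. Qed.

Let psi (x : 'rV[R]_n) : R[i] := k%:C%C + t * (w x)%:C%C.
Let grad i (x : 'rV[R]_n) : R[i] := t * (pd i w x)%:C%C.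
Let hess i j (x : 'rV[R]_n) : R[i] := t * (pd j (pd i w) x)%:C%C.
Let divh i j (x : 'rV[R]_n) : R[i] := t * (pd i (fun y => a y i j * pd j w y) x)%:C%C.

Lemma affine_in_L2 (c z : R[i]) (U : 'rV[R]_n -> R) : bdd Om U ->
  in_L2 leb Om (fun x => c + z * (U x)%:C%C).
Proof.
move=> bU.
have bR : bdd Om (fun x => complex.Re (c + z * (U x)%:C%C)).
  apply: bdd_eq (bddD (bdd_cst _ (complex.Re c)) (bddZ (complex.Re z) bU)) => x _.
  by rewrite Re_affine.
have bI : bdd Om (fun x => complex.Im (c + z * (U x)%:C%C)).
  apply: bdd_eq (bddD (bdd_cst _ (complex.Im c)) (bddZ (complex.Im z) bU)) => x _.
  by rewrite Im_affine.
split; first by split; [case: bR|case: bI].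
rewrite /L2sq.
have bS := bddD (bddM bR bR) (bddM bI bI).
under eq_integral do rewrite /sqnormc !expr2.
by rewrite (bdd_integralE mOm Omoo bS) ltry.
Qed.

Lemma scale_in_L2 (z : R[i]) (U : 'rV[R]_n -> R) : bdd Om U ->
  in_L2 leb Om (fun x => z * (U x)%:C%C).
Proof.
by move=> /(affine_in_L2 0 z); under [X in in_L2 _ _ X]eq_fun do rewrite add0r.
Qed.

Lemma weak_pd_scale i (z : R[i]) (U : 'rV[R]_n -> R) :
  (forall x, Om x -> {for x, continuous U}) ->
  (forall x, Om x -> derivable U x (delta_mx ord0 i)) ->
  (forall x, Om x -> {for x, continuous (pd i U)}) ->
  weak_pd Om i (fun x => z * (U x)%:C%C) (fun x => z * (pd i U x)%:C%C).
Proof.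
move=> cU dU cdU; have := weak_pd_affine 0 z cU dU cdU.
by under [X in weak_pd _ _ X _]eq_fun do rewrite add0r.
Qed.

Lemma H1_psi : H1_grad Om psi grad.
Proof.
split; first exact: (affine_in_L2 _ _ (Ck_bdd oO bO Cw)).
move=> i; split; first exact: (scale_in_L2 _ (Ck_bdd oO bO (Ck_pd i Cw))).
apply: weak_pd_affine => x _.
- exact: (Ck_continuous Cw).
- by case: (Ck_is_derive i x Cw).
- exact: (Ck_continuous (Ck_pd i Cw)).
Qed.

Lemma H2_psi : H2_jet Om psi grad hess.
Proof.
split; first exact: H1_psi.
move=> i; split; first exact: (scale_in_L2 _ (Ck_bdd oO bO (Ck_pd i Cw))).
move=> j; split; first exact: (scale_in_L2 _ (Ck_bdd oO bO (Ck_pd j (Ck_pd i Cw)))).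
apply: weak_pd_scale => x _.
- exact: (Ck_continuous (Ck_pd i Cw)).
- by case: (Ck_is_derive j x (Ck_pd i Cw)).
- exact: (Ck_continuous (Ck_pd j (Ck_pd i Cw))).
Qed.

Let flux i j y := a y i j * pd j w y.

Let pd_fluxE i j x : Om x -> pd i (flux i j) x =
  pd i (fun y => a y i j) x * pd j w x + a x i j * pd i (pd j w) x.
Proof. exact: (pd_flux Ca i j i (Ck_pd j Cw)). Qed.

Let flux_bdd i j : bdd Om (pd i (flux i j)).
Proof.
apply: bdd_eq (bddD (bddM (pd_coef_bdd oO bO Ca i i j) (Ck_bdd oO bO (Ck_pd j Cw)))
  (bddM (coef_bdd oO bO Ca i j) (Ck_bdd oO bO (Ck_pd i (Ck_pd j Cw))))) => x Ox.
by rewrite pd_fluxE.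
Qed.

Lemma minus_div_psi :
  minus_div_a_grad Om a psi (fun x => t * (- div_grad a w x)%:C%C).
Proof.
exists grad, divh; split; first exact: H1_psi.
- move=> i j; have Cj := Ck_pd j Cw.
  split; first exact: (scale_in_L2 _ (flux_bdd i j)).
  rewrite (_ : (fun x => _) = fun x => t * (flux i j x)%:C%C); last first.
    by apply/funext => x; rewrite /flux rmorphM mulrCA.
  have [[ca /(_ i)[_ [cda _]]] _ _] := Ca i j.
  apply: weak_pd_scale => x Ox.
  + exact: (continuousM (ca x Ox) (Ck_continuous Cj x)).
  + by case: (is_derive_flux Ca i j i Cj Ox).
  + apply: near_eq_continuous_at.
      by apply: filterS (open_nbhs_nbhs (conj oO Ox)) => y Oy; exact: pd_fluxE.
    apply: continuous_add.
      exact: (continuousM (cda x Ox) (Ck_continuous Cj x)).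
    exact: (continuousM (ca x Ox) (Ck_continuous (Ck_pd i Cj) x)).
- move=> x Ox; rewrite rmorphN mulrN; congr (- _).
  rewrite /div_grad rmorph_sum mulr_sumr; apply: eq_bigr => i _.
  by rewrite rmorph_sum mulr_sumr.
Qed.

(** The state is continuous up to the boundary, so the constant sequence equal to it
    is admissible in the definition of its trace. *)
Lemma psi_Hmu (mu : probability 'rV[R]_n R) avg : mu Om = 1%E ->
  H2_mean Om mu avg -> (forall x, bdry Om x -> w x = 0) ->
  \int[mu]_(x in Om) w x = 0 ->
  Hmu Om a avg psi (fun x => t * (- div_grad a w x)%:C%C).
Proof.
move=> mu1 [_ _ havg] w0 mw; split; last exact: minus_div_psi.
have H2 : in_H2 Om psi by exists grad, hess; exact: H2_psi.
have cw : continuous w := Ck_continuous Cw.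
have cpsi : cfun_continuous_closure Om psi.
  have cRI b c' : continuous (fun x => b + c' * w x).
    by move=> x; apply: continuous_affine; exact: cw.
  split; apply: continuous_subspaceT.
    rewrite (_ : (fun x => _) = fun x => complex.Re k%:C%C + complex.Re t * w x).
      exact: cRI.
    by apply/funext => x; rewrite Re_affine.
  rewrite (_ : (fun x => _) = fun x => complex.Im k%:C%C + complex.Im t * w x).
    exact: cRI.
  by apply/funext => x; rewrite Im_affine.
have muoo : (mu Om < +oo)%E by rewrite mu1 ltry.
have key b c : \int[mu]_(x in Om) (b + c * w x) = b.
  have bw := Ck_bdd oO bO Cw.
  rewrite (bdd_RintegralD mOm muoo (bdd_cst _ b) (bddZ c bw)).
  rewrite (bdd_RintegralZ mOm muoo c bw) mw mulr0 addr0.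
  transitivity (b * fine (mu Om)); first exact: Rintegral_cst.
  by rewrite mu1 mulr1.
have avgE : avg psi = k%:C%C.
  rewrite havg// /cintegral.
  under eq_Rintegral do rewrite Re_affine.
  rewrite key; under eq_Rintegral do rewrite Im_affine.
  by rewrite key.
split=> //; split; first by split; exact: measurable_cst.
exists (fun=> psi); split => //.
- exists (fun=> grad), grad; split => //.
  + by move=> _; exact: H1_psi.
  + exact: H1_psi.
  + rewrite (_ : (fun k0 => _) = fun=> 0%E); first exact: cvg_cst.
    apply/funext => _; apply: integral0_eq => x _.
    by rewrite /= subrr /sqnormc /= expr0n /= addr0.
  + move=> i; rewrite (_ : (fun k0 => _) = fun=> 0%E); first exact: cvg_cst.
    apply/funext => _; apply: integral0_eq => x _.
    by rewrite /= subrr /sqnormc /= expr0n /= addr0.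
- rewrite (_ : (fun k0 => _) = fun=> 0%E); first exact: cvg_cst.
  apply/funext => _; apply: integral0_eq => x bx.
  by rewrite /= avgE /psi w0// mulr0 addr0 subrr /sqnormc /= expr0n /= addr0.
Qed.

Let V := fine (leb Om).
Let I f := \int[leb]_(x in Om) f x.
Let L x := - div_grad a w x.

Let bw : bdd Om w. Proof. exact: (Ck_bdd oO bO Cw). Qed.
Let bL : bdd Om L.
Proof.
by apply: bdd_eq (bddZ (-1) (div_grad_bdd oO bO Ca Cw)) => x _; rewrite mulN1r.
Qed.

Lemma L2sq_psi : L2sq leb Om psi = (k ^+ 2 * V + 2 * k * complex.Re t * I w +
  (complex.Re t ^+ 2 + complex.Im t ^+ 2) * I (fun x => w x ^+ 2))%:E.
Proof.
have bw2 : bdd Om (fun x => w x ^+ 2).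
  by apply: bdd_eq (bddM bw bw) => x _; rewrite expr2.
have b1 := bddD (bdd_cst Om (k ^+ 2)) (bddZ (2 * k * complex.Re t) bw).
have b2 := bddZ (complex.Re t ^+ 2 + complex.Im t ^+ 2) bw2.
rewrite /L2sq.
under eq_integral => x _.
  rewrite (_ : sqnormc (psi x) = k ^+ 2 + 2 * k * complex.Re t * w x +
    (complex.Re t ^+ 2 + complex.Im t ^+ 2) * w x ^+ 2).
    over.
  by rewrite /sqnormc Re_affine Im_affine /=; ring.
rewrite (bdd_integralE mOm Omoo (bddD b1 b2)); congr (_%:E).
rewrite (bdd_RintegralD mOm Omoo b1 b2).
rewrite (bdd_RintegralD mOm Omoo (bdd_cst _ _) (bddZ _ bw)).
by rewrite (bdd_RintegralZ mOm Omoo _ bw) (bdd_RintegralZ mOm Omoo _ bw2) Rintegral_cst.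
Qed.

Lemma L2inner_psi : L2inner leb Om (fun x => t * (L x)%:C%C) psi =
  ((k * complex.Re t * I L +
   (complex.Re t ^+ 2 + complex.Im t ^+ 2) * I (fun x => L x * w x))
   +i* (k * complex.Im t * I L))%C.
Proof.
have bLw := bddM bL bw.
apply: eqCE; rewrite /L2inner /cintegral /=.
  under eq_Rintegral => x _.
    rewrite (_ : complex.Re _ = k * complex.Re t * L x +
      (complex.Re t ^+ 2 + complex.Im t ^+ 2) * (L x * w x)).
      over.
    by rewrite /psi; case: (t) => t1 t2 /=; ring.
  rewrite (bdd_RintegralD mOm Omoo (bddZ _ bL) (bddZ _ bLw)).
  by rewrite (bdd_RintegralZ mOm Omoo _ bL) (bdd_RintegralZ mOm Omoo _ bLw).
under eq_Rintegral => x _.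
  rewrite (_ : complex.Im _ = k * complex.Im t * L x).
    over.
  by rewrite /psi; case: (t) => t1 t2 /=; ring.
by rewrite (bdd_RintegralZ mOm Omoo _ bL).
Qed.

End test_state.

Lemma open_lebesgue_gt0 (R : realType) n (D : set 'rV[R]_n) :
  open D -> D !=set0 -> (0 < lebesgue_rV n D)%E.
Proof.
move=> oD [x Dx].
have /nbhs_ballP[r /= r0 rD] := open_nbhs_nbhs (conj oD Dx).
apply: (@lt_le_trans _ _ (lebesgue_rV n (ball x r))).
  by rewrite lebesgue_rV_ball// lte_fin exprn_gt0// mulrn_wgt0.
apply: le_measure => //; rewrite inE.
  by apply: open_measurable_rV; exact: ball_open.
exact: open_measurable_rV.
Qed.

Theorem theorem3p1 (R : realType) (d : nat) (Omega : set 'rV[R]_d)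
    (a : 'rV[R]_d -> 'M[R]_d) (mu : probability 'rV[R]_d R)
    (avg : ('rV[R]_d -> R[i]) -> R[i]) :
  (2 <= d)%N ->
  open Omega -> bounded_set Omega -> connected Omega -> C2_smooth Omega ->
  (forall i j, C1_closure Omega (fun x => a x i j)) ->
  (forall x, Omega x -> (a x)^T = a x) ->
  (exists2 c : R, 0 < c & forall (x xi : 'rV[R]_d), Omega x ->
     c * enorm xi ^+ 2 <= (xi *m a x *m xi^T) ord0 ord0) ->
  mu Omega = 1%E -> radon mu -> H2_mean Omega mu avg ->
  numerical_range Omega (Hmu Omega a avg) = setT.
Proof.
move=> d2 oO bO _ sO Ca _ [c c0 ell] mu1 _ havg.
apply/seteqP; split => // z _.
have O0 : Omega !=set0.
  apply/set0P; apply/negP => /eqP O0; move: mu1; rewrite O0 measure0.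
  by move=> /eqP; rewrite eq_sym onee_eq0.
have Ooo := open_bounded_lt_oo oO bO.
pose V := fine (lebesgue_rV d Omega).
have V0 : 0 < V by rewrite fine_gt0// Ooo open_lebesgue_gt0.
pose e0 : 'I_d := Ordinal (ltnW d2).
have [K [e [sg [rho [chi Col]]]]] := boundary_collar e0 oO bO O0 sO.
have [F0 F00 hw] := mean_zero_layer oO bO Ca Col c0 ell mu.
have [eps eps0 hN] := numerical_range_equation (complex.Re z) (complex.Im z) V0 F00.
have [w [Cw w0 [mw hF hA hm hB]]] := hw eps eps0.
have [x [y [N [N0 NE E1 E2]]]] := hN _ _ _ _ hF hA hm hB.
pose k := Num.sqrt N^-1.
have k2 : k ^+ 2 = N^-1 by rewrite sqr_sqrtr// invr_ge0 ltW.
pose t : R[i] := (k * x +i* (k * y))%C.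
exists (fun u => k%:C%C + t * (w u)%:C%C), (fun u => t * (- div_grad a w u)%:C%C); split.
- exact: psi_Hmu mu1 havg w0 mw.
- rewrite L2sq_psi//; congr (_%:E); rewrite /t /=.
  set m := \int[_]_(u in _) w u in NE *.
  set B := \int[_]_(u in _) (w u ^+ 2) in NE *.
  rewrite -/V (_ : _ + _ = k ^+ 2 * (V + 2 * x * m + (x ^+ 2 + y ^+ 2) * B)); last ring.
  by rewrite -NE k2 mulVf// gt_eqF.
- rewrite L2inner_psi//; apply: eqCE => /=.
    set F := \int[_]_(u in _) (- div_grad a w u) in E1 *.
    set A := \int[_]_(u in _) (- div_grad a w u * w u) in E1 *.
    rewrite (_ : _ + _ = k ^+ 2 * (x * F + (x ^+ 2 + y ^+ 2) * A)); last ring.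
    by rewrite E1 k2 mulrCA mulVf ?mulr1// gt_eqF.
  set F := \int[_]_(u in _) (- div_grad a w u) in E2 *.
  rewrite (_ : k * (k * y) * F = k ^+ 2 * (y * F)); last by ring.
  by rewrite E2 k2 mulrCA mulVf ?mulr1// gt_eqF.
Qed.
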